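(* Let $I,J\subset\mathbb{R}$ be open intervals, let $U\subset\mathbb{C}$ be open and let $\Phi: I\times J\to U$, $(s,p)\mapsto\Phi(s,p)$, be a $C^2$-diffeomorphism. Put $\Gamma=\{\Phi(\cdot,p)\ |\ p\in J\}$. Let $q$ be a holomorphic quadratic differential on $U$ such that every curve in $\Gamma$ is a horizontal trajectory of $q$. For $z\in U$ let $l_\Gamma(z)=l_q\big(\Phi(\cdot,\Phi_2^{-1}(z))\big)$, where $\Phi^{-1}=(\Phi^{-1}_1,\Phi^{-1}_2):U\to I\times J$; that is, $l_\Gamma(z)$ is the $q$-length of the curve of $\Gamma$ passing through $z$. Assume that $l_\Gamma$ takes values in $]0,+\infty[$. Then $$M_2(\Gamma)=\int_U\frac{|q|}{(l_\Gamma)^2}\,\mathrm{d}L^2 .$$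
   Context: A holomorphic quadratic differential on an open set $U\subset\mathbb{C}$ is an expression $q(z)\,\mathrm{d}z^2$ with $q:U\to\mathbb{C}$ holomorphic; it is identified with the function $q$. A $C^1$ curve $\gamma: I\to U$ is a horizontal trajectory of $q$ if $q(\gamma(s))\,\dot\gamma(s)^2$ is real and $>0$ for all $s\in I$. The $q$-length of $\gamma$ is $l_q(\gamma)=\int_I\sqrt{|q(\gamma(s))|}\,|\dot\gamma(s)|\,\mathrm{d}s$. For a family $\Gamma$ of $C^1$ curves in $U$, $\mathrm{adm}(\Gamma)$ is the set of Borel measurable functions $\rho:U\to[0,\infty]$ such that $\int_a^b\rho(\gamma(s))\,|\dot\gamma(s)|\,\mathrm{d}s\ge 1$ for every curve $\gamma:\,]a,b[\,\to U$ in $\Gamma$. The $2$-modulus of $\Gamma$ is $M_2(\Gamma)=\inf_{\rho\in\mathrm{adm}(\Gamma)}\int_U\rho^2\,\mathrm{d}L^2$, where $L^2$ is Lebesgue measure on $\mathbb{R}^2\cong\mathbb{C}$. Equalities between integrals and moduli are in $[0,+\infty]$. *)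

(* Defs.v *)
(* C is R[i], for an arbitrary R : realType. *)
From mathcomp Require Import all_boot all_order all_algebra.
From mathcomp Require Import all_classical all_reals all_analysis.
From mathcomp Require Import measurable_realfun complex.
Set Implicit Arguments.
Unset Strict Implicit.
Unset Printing Implicit Defensive.
Import Order.TTheory GRing.Theory Num.Theory.
Import numFieldNormedType.Exports.
Import Normc.
Local Open Scope complex_scope.
Local Open Scope ring_scope.
Local Open Scope classical_set_scope.

Definition open_interval (R : realType) (I : set R) : Prop :=
  [/\ open I, is_interval I & I !=set0].

(* R[i] carries neither a real normed-module structure nor a measurable one in
   the library; real differentiability, Borel measurability and L^2 are
   transported along these two mutually inverse maps, R * R being equipped with
   the product topology, the product sigma-algebra (that is, the Borel one) and
   the product Lebesgue measure. *)
Definition toC (R : realType) (p : R * R) : R[i] := p.1 +i* p.2.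

Definition toR2 (R : realType) (z : R[i]) : R * R :=
  (complex.Re z, complex.Im z).

Definition open_in_C (R : realType) (U : set R[i]) : Prop :=
  open (U : set R[i]^o).

Definition L2 (R : realType) := (@lebesgue_measure R \x @lebesgue_measure R)%E.

Definition integral_C (R : realType) (U : set R[i]) (f : R[i] -> \bar R) :
    \bar R :=
  (\int[@L2 R]_(p in @toC R @^-1` U) f (toC p))%E.

Definition borel_on (R : realType) (U : set R[i]) (f : R[i] -> \bar R) : Prop :=
  measurable_fun (@toC R @^-1` U) (f \o @toC R).

(* Meant for open A and finite-dimensional V, where continuity of every
   directional derivative amounts to continuity of the differential. *)
Fixpoint classC (n : nat) (R : realType) (V W : normedModType R)
    (A : set V) (f : V -> W) : Prop :=
  if n is m.+1 then
    (forall x, A x -> differentiable f x) /\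
    (forall v : V, classC m A (fun x => 'D_v f x))
  else forall x, A x -> {for x, continuous f}.

(* Phi and Psi are total functions, of which only the restrictions to A and U
   matter. *)
Definition C2_diffeomorphism (R : realType) (A : set (R * R)) (U : set R[i])
    (Phi : R * R -> R[i]) (Psi : R[i] -> R * R) : Prop :=
  [/\ forall x, A x -> U (Phi x) /\ Psi (Phi x) = x,
      forall z, U z -> A (Psi z) /\ Phi (Psi z) = z,
      classC 2 A (@toR2 R \o Phi) &
      classC 2 (@toC R @^-1` U) (Psi \o @toC R)].

(* [derivable] along 1 over the field R[i] itself, i.e. existence of the complex
   derivative. *)
Definition holomorphic (R : realType) (U : set R[i]) (q : R[i] -> R[i]) : Prop :=
  forall z, U z -> derivable (q : R[i]^o -> R[i]^o) z 1.

(* A curve comes with its interval of parameters, outside which the values of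
   the function are irrelevant. *)
Definition curve (R : realType) : Type := (set R * (R -> R[i]))%type.

Definition velocity (R : realType) (g : R -> R[i]) (s : R) : R[i] :=
  toC (derive1 (@toR2 R \o g) s).

Definition C1_curve_in (R : realType) (U : set R[i]) (c : curve R) : Prop :=
  (forall s, c.1 s -> U (c.2 s)) /\ classC 1 c.1 (@toR2 R \o c.2).

(* For w : R[i], 0 < w means that w is real and positive. *)
Definition horizontal_trajectory (R : realType) (U : set R[i])
    (q : R[i] -> R[i]) (c : curve R) : Prop :=
  C1_curve_in U c /\
  forall s, c.1 s -> 0 < q (c.2 s) * velocity c.2 s ^+ 2.

Definition q_length (R : realType) (q : R[i] -> R[i]) (c : curve R) : \bar R :=
  (\int[@lebesgue_measure R]_(s in c.1)
     (Num.sqrt (normc (q (c.2 s))) * normc (velocity c.2 s))%:E)%E.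

Definition adm (R : realType) (U : set R[i]) (Gamma : set (curve R)) :
    set (R[i] -> \bar R) :=
  [set rho | [/\ forall z, U z -> (0 <= rho z)%E,
     borel_on U rho &
     forall c, Gamma c ->
       (1 <= \int[@lebesgue_measure R]_(s in c.1)
               (rho (c.2 s) * (normc (velocity c.2 s))%:E))%E]].

Definition M2 (R : realType) (U : set R[i]) (Gamma : set (curve R)) : \bar R :=
  ereal_inf [set integral_C U (fun z => rho z ^+ 2)%E | rho in adm U Gamma].

Definition coord_curve (R : realType) (I : set R) (Phi : R * R -> R[i])
    (p : R) : curve R := (I, fun s => Phi (s, p)).

Definition coord_family (R : realType) (I J : set R) (Phi : R * R -> R[i]) :
    set (curve R) := [set coord_curve I Phi p | p in J].

Definition l_Gamma (R : realType) (I : set R) (Phi : R * R -> R[i])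
    (Psi : R[i] -> R * R) (q : R[i] -> R[i]) (z : R[i]) : \bar R :=
  q_length q (coord_curve I Phi (Psi z).2).

(* Main.v *)
From HB Require Import structures.
Require Import Defs.
From mathcomp Require Import all_boot all_order all_algebra.
From mathcomp Require Import all_classical all_reals all_analysis.
From mathcomp Require Import measurable_realfun complex.
From mathcomp Require Import ring lra.
Import Order.TTheory GRing.Theory Num.Theory.
Import numFieldNormedType.Exports.
Import Normc.
Local Open Scope complex_scope.
Local Open Scope ring_scope.
Local Open Scope classical_set_scope.

(** Write g and k for the partial derivatives of Phi in s and in p.  Along the
curves lam = q(Phi) g^2 is real and positive, and
   d/ds (sqrt lam * k / g) = d/dp (sqrt lam),
an identity which only uses that q is complex differentiable and that the mixed
second derivatives of Phi agree.  Taking imaginary parts, sqrt |q| det DPhi / |g|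
does not depend on s, that is |det DPhi| = D(p) |g| / sqrt |q|.  In the coordinates
(s, p) the problem thus splits into one problem per curve: with rho0 = sqrt |q| / l,
integrating rho^2 + rho0^2 >= 2 rho rho0 along the curve of parameter p gives
   D(p) * int rho^2 |g| / sqrt |q| ds >= D(p) / l(p),
with equality for rho0.  As l(p) is finite, this needs no finiteness of the modulus.

The change of variables formula in the plane follows Goursat's bisection: if the
area of the image of a box and the integral of the Jacobian differed too much,
then so they would on a nested sequence of boxes shrinking to a point, against the
differentiability of Phi and of its inverse there. *)

(** * Change of variables in the plane *)

(** The identity comes from the natural parameter w of q, with dw = sqrt q dz. In this coordinate
    the curves are horizontal segments, so Im w depends on p alone, and so does its p-derivative Im
    (sqrt q * k), whose absolute value is D(p). Working with the square lam * Im (k / g)^2 requires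
    neither a branch of sqrt q nor the construction of w.

    In the change of variables, bisection uses differentiability at one point at a time, hence no
    uniform estimate and no inverse function theorem. The error allowed on a box is proportional to
    its area; being additive, it survives the division into quarters. Only boxes whose closure lies
    in the open set are compared, because the Jacobian is bounded there and both measures are
    finite. Countably many such boxes then give all Borel sets, and simple functions give all
    nonnegative integrands. *)

Section affine.
Context {R : realType}.
Notation mu := (@lebesgue_measure R).

Lemma measurable_affine (a c : R) : measurable_fun [set: R] (fun y : R => a * y + c).
Proof.
apply: continuous_measurable_fun => x.
by apply: cvgD; [apply: cvgM; [exact: cvg_cst|exact: cvg_id]|exact: cvg_cst].
Qed.

Lemma itv_affine_preimage (a c u v : R) : a != 0 ->
  mu ((fun y => a * y + c) @^-1` `]u, v]) = ((`|a|^-1)%:E * mu `]u, v])%E.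
Proof.
move=> a0.
have [a_gt0|a_le0] := ltP 0 a.
  have -> : (fun y => a * y + c) @^-1` `]u, v] = `](u - c) / a, (v - c) / a]%classic.
    apply/seteqP; split=> y /=; rewrite !in_itv/= ltr_pdivrMr// ler_pdivlMr//;
     by rewrite ltrBlDr lerBrDr (mulrC y).
  rewrite !lebesgue_measure_itv/= !lte_fin ltr_pM2r ?invr_gt0// ltrD2r.
  case: ifPn => _; last by rewrite mule0.
  by rewrite -!EFinD -EFinM gtr0_norm//; congr EFin; field.
have {a_le0} a_lt0 : a < 0 by rewrite lt_neqAle a0.
(* A negative slope reverses the order, so the closed end moves to the left; the length is the
   same. *)
have -> : (fun y => a * y + c) @^-1` `]u, v] = `[(v - c) / a, (u - c) / a[%classic.
  apply/seteqP; split=> y /=; rewrite !in_itv/= ltr_ndivlMr// ler_ndivrMr//;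
    by rewrite ltrBlDr lerBrDr (mulrC y) andbC.
rewrite !lebesgue_measure_itv/= !lte_fin ltr_nM2r ?invr_lt0// ltrD2r.
case: ifPn => _; last by rewrite mule0.
by rewrite -!EFinD -EFinM ltr0_norm//; congr EFin; field.
Qed.

(** Lebesgue measure is the only measure that gives half-open intervals their length, and the
    pushforward by the affine map, scaled by |a|, does so. *)
Lemma lebesgue_measure_affine (a c : R) (B : set R) : a != 0 -> measurable B ->
  mu ((fun y => a * y + c) @^-1` B) = ((`|a|^-1)%:E * mu B)%E.
Proof.
move=> a0 mB.
have a1 : 0 <= `|a| by [].
pose f := (fun y : R => a * y + c) : measurableTypeR R -> measurableTypeR R.
have mf : measurable_fun setT f by exact: measurable_affine.
pose pf : {measure set (measurableTypeR R) -> \bar R} :=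
  measure_function_pushforward__canonical__measure_function_Measure mu mf.
have := @lebesgue_measure_unique R (mscale (NngNum a1) pf).
move=> /(_ _ B mB) ->; last first.
  move=> X [[u v] _ <-] /=; rewrite /mscale /= /pushforward itv_affine_preimage//.
  by rewrite muleA -EFinM mulfV ?normr_eq0// mul1e.
by rewrite /mscale/= /pushforward muleA -EFinM mulVf ?normr_eq0// mul1e.
Qed.

End affine.

(** * Area of preimages under affine maps of the plane *)

Section planar.
Context {R : realType}.
Notation mu := (@lebesgue_measure R).
Notation RR := (measurableTypeR R).
Notation mu2 := (@lebesgue_measure R \x @lebesgue_measure R)%E.

Definition aff2 (a b c : R) (z : R * R) : R := a * z.1 + b * z.2 + c.

Lemma measurable_aff2 (a b c : R) :
  measurable_fun [set: RR * RR] (aff2 a b c : RR * RR -> RR).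
Proof.
apply: measurable_funD; last exact: measurable_cst.
by apply: measurable_funD; apply: measurable_funM;
  [exact: measurable_cst|exact: measurable_fst|exact: measurable_cst|exact: measurable_snd].
Qed.

(** [\x] integrates the measures of the sections at fixed first coordinate. The iterated integral in
    the other order is a measure with the same values on rectangles, hence the same measure. *)
Lemma lebesgue2_ysection (E : set (RR * RR)) : measurable E ->
  mu2 E = (\int[mu]_y mu (ysection E y))%E.
Proof.
move=> mE; rewrite [RHS](_ : _ = (mu \x^ mu)%E E)//.
apply: product_measure_unique => // A B mA mB.
exact: product_measure2E.
Qed.

Lemma measurable_preimage2 (a b c a' b' c' : R) (A B : set RR) :
  measurable A -> measurable B ->
  measurable ([set z | A (aff2 a b c z) /\ B (aff2 a' b' c' z)] : set (RR * RR)).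
Proof.
move=> mA mB; apply: measurableI.
  by rewrite -[X in measurable X]setTI; exact: measurable_aff2.
by rewrite -[X in measurable X]setTI; exact: measurable_aff2.
Qed.

(* Substitute for z.1 at fixed z.2, exchange the integrals, then substitute for z.2. *)
Lemma lebesgue2_affine_pivot (a b c a' b' c' : R) (A B : set R) :
  measurable A -> measurable B -> a != 0 -> a * b' - b * a' != 0 ->
  mu2 [set z | A (aff2 a b c z) /\ B (aff2 a' b' c' z)] =
  ((`|a * b' - b * a'|^-1)%:E * (mu A * mu B))%E.
Proof.
move=> mA mB a0 D0; set D := a * b' - b * a' in D0 *.
(* With x' = a x + b y + c as new first variable, the second form becomes (a'/a) x' + (D/a) y + c' -
   (a'/a) c; [E'] is the set in the coordinates (x', y). *)
pose E' := [set z | A (aff2 1 0 0 z) /\ B (aff2 (a' / a) (D / a) (c' - a' / a * c) z)]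
  : set (RR * RR).
have mE' : measurable E' by exact: measurable_preimage2.
rewrite lebesgue2_ysection; last exact: measurable_preimage2.
transitivity (\int[mu]_y ((`|a|^-1)%:E * mu (ysection E' y)))%E.
  apply: eq_integral => y _; rewrite -(lebesgue_measure_affine a (b * y + c))//; last first.
    exact: measurable_ysection.
  congr (mu _); apply/seteqP; split => x /=; rewrite /ysection/= !inE /aff2/=;
    (move=> [h1 h2]; split; [move: h1|move: h2]);
    match goal with |- _ ?x -> _ ?y => suff -> : x = y by [] end; rewrite /D /aff2 /=; by field.
rewrite (@ge0_integralZl _ _ _ mu setT measurableT (mu \o ysection E'))//=; last first.
  exact: (@measurable_fun_ysection _ _ _ _ _ mu E' mE').
rewrite -lebesgue2_ysection// [mu2 E'](_ : _ = (\int[mu]_x mu (xsection E' x))%E)//.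
transitivity ((`|a|^-1)%:E * \int[mu]_(x in A) (cst ((`|D / a|^-1)%:E * mu B)) x)%E.
  congr (_ * _)%E; rewrite [RHS]integral_mkcond; apply: eq_integral => x _.
  rewrite patchE; case: ifPn => [/set_mem Ax|/negP nAx].
    have -> : xsection E' x =
        (fun y => (D / a) * y + (a' / a * x + (c' - a' / a * c))) @^-1` B.
      apply/seteqP; split => y /=; rewrite /xsection/= !inE /E' /aff2/= mul1r mul0r !addr0.
        move=> [_]; match goal with |- _ ?x -> _ ?y => suff -> : x = y by [] end; ring.
      move=> h; split=> //; move: h.
      match goal with |- _ ?x -> _ ?y => suff -> : x = y by [] end; ring.
    by rewrite lebesgue_measure_affine// mulf_neq0// invr_neq0.
  have -> : xsection E' x = set0.
    apply/seteqP; split => y //=; rewrite /xsection/= !inE /E' /aff2/= mul1r mul0r !addr0.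
    by case=> Ax; exfalso; apply: nAx; rewrite inE.
  by rewrite measure0.
rewrite integral_cst// -muleA (muleA (`|a|^-1)%:E) -EFinM (muleC (mu B)); congr (_%:E * _)%E.
by rewrite -invfM -normrM mulrC divfK.
Qed.

Lemma lebesgue2_swap (E : set (RR * RR)) : measurable E -> mu2 [set z | E (z.2, z.1)] = mu2 E.
Proof.
move=> mE.
have msw : measurable_fun setT (fun z : RR * RR => (z.2, z.1) : RR * RR).
  by apply: measurable_fun_pair; [exact: measurable_snd|exact: measurable_fst].
pose m' : {measure set (RR * RR) -> \bar R} :=
  measure_function_pushforward__canonical__measure_function_Measure mu2 msw.
rewrite -[LHS]/(m' E); apply/esym/product_measure_unique => // A B mA mB.
rewrite /m'/= /pushforward [X in mu2 X](_ : _ = B `*` A); last first.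
  by apply/seteqP; split => -[x y] /= [].
by rewrite product_measure1E// muleC.
Qed.

Lemma lebesgue2_affine_preimage (a b c a' b' c' : R) (A B : set R) :
  measurable A -> measurable B -> a * b' - b * a' != 0 ->
  mu2 [set z | A (aff2 a b c z) /\ B (aff2 a' b' c' z)] =
  ((`|a * b' - b * a'|^-1)%:E * (mu A * mu B))%E.
Proof.
move=> mA mB; have [->|a0] := eqVneq a 0; last exact: lebesgue2_affine_pivot.
rewrite mul0r sub0r normrN oppr_eq0 => D0.
have b0 : b != 0 by apply: contraNneq D0 => ->; rewrite mul0r.
(* Exchanging the coordinates makes b the pivot and only changes the sign of the determinant. *)
rewrite -lebesgue2_swap; last exact: measurable_preimage2.
transitivity (mu2 [set z | A (aff2 b 0 c z) /\ B (aff2 b' a' c' z)]); last first.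
  by rewrite lebesgue2_affine_pivot// mul0r subr0.
congr (mu2 _); apply/seteqP; split => -[x y] /=;
  by rewrite /aff2/= (addrC (0 * _)) (addrC (a' * _)).
Qed.

End planar.

(** * Open sets as countable unions of boxes *)

Section openplane.
Context {R : realType}.
Notation RR := (measurableTypeR R).

Definition ocbox (a b c d : R) : set (R * R) := `]a, b] `*` `]c, d].
Definition ccbox (a b c d : R) : set (R * R) := `[a, b] `*` `[c, d].

(** Half-open boxes are stable under intersection and split into disjoint halves; their closures are
    kept inside [W] so that continuous functions on [W] are bounded on them. *)
Lemma open_bigcup_boxes (W : set (R * R)) : open W ->
  exists a b c d : nat -> R,
    (forall n, ccbox (a n) (b n) (c n) (d n) `<=` W) /\
    W = \bigcup_n ocbox (a n) (b n) (c n) (d n).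
Proof.
move=> oW.
pose Q := (rat * rat * rat * rat)%type.
pose cb (t : Q) : set (R * R) :=
  ccbox (ratr t.1.1.1) (ratr t.1.1.2) (ratr t.1.2) (ratr t.2).
(* An empty box, since its first side runs from 1 to 0. It is the default for indices that code no
   box and for boxes not contained in [W]. *)
pose t0 : Q := (1, 0, 0, 0).
pose f n : Q := if unpickle n is Some t then (if `[< cb t `<=` W >] then t else t0) else t0.
have cb0 : cb t0 = set0.
  apply/seteqP; split => -[x y] //= -[] /=; rewrite in_itv/= => /andP[h1 h2].
  by have := le_trans h1 h2; rewrite ler_rat.
have fW n : cb (f n) `<=` W.
  rewrite /f; case: unpickle => [t|]; last by rewrite cb0.
  by case: asboolP => // _; rewrite cb0.
exists (fun n => ratr (f n).1.1.1), (fun n => ratr (f n).1.1.2),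
  (fun n => ratr (f n).1.2), (fun n => ratr (f n).2); split; first exact: fW.
apply/seteqP; split => [x Wx|x [n _ hx]]; last first.
  apply: (fW n); move: hx => [] /=; rewrite !in_itv/= => /andP[h1 h2] /andP[h3 h4].
  by split; rewrite /= in_itv/= ?h2 ?h4 ?(ltW h1) ?(ltW h3).
have /nbhs_ballP[e /= e0 xeW] : nbhs x W by exact: open_nbhs_nbhs.
have lt1 (y : R) : y - e < y by rewrite ltrBlDr ltrDl.
have lt2 (y : R) : y < y + e by rewrite ltrDl.
have [p1] := rat_in_itvoo (lt1 x.1); have [p2] := rat_in_itvoo (lt2 x.1).
have [p3] := rat_in_itvoo (lt1 x.2); have [p4] := rat_in_itvoo (lt2 x.2).
rewrite !in_itv/= => /andP[h1 h2] /andP[h3 h4] /andP[h5 h6] /andP[h7 h8].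
have [] : exists t : Q, cb t `<=` W /\ ocbox (ratr t.1.1.1) (ratr t.1.1.2) (ratr t.1.2) (ratr t.2) x.
  exists (p1, p2, p3, p4); split=> /=; last first.
    by split; rewrite /= in_itv/=; apply/andP; split => //; apply: ltW.
  move=> y [] /=; rewrite !in_itv/= => /andP[k1 k2] /andP[k3 k4].
  by apply: xeW; split; rewrite /ball/= ltr_norml; apply/andP; split; lra.
move=> t' [t'W t'x]; exists (pickle t') => //.
by rewrite /f pickleK asboolT.
Qed.

Lemma measurable_ocbox (a b c d : R) : measurable (ocbox a b c d : set (RR * RR)).
Proof. by apply: measurableX; exact: measurable_itv. Qed.

Lemma open_measurable2 (W : set (R * R)) : open W -> measurable (W : set (RR * RR)).
Proof.
move=> /open_bigcup_boxes[a [b [c [d [_ ->]]]]].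
by apply: bigcup_measurable => n _; exact: measurable_ocbox.
Qed.

Lemma continuous_measurable2 (W : set (R * R)) (f : R * R -> R) : open W ->
  (forall x, W x -> {for x, continuous f}) ->
  measurable_fun (W : set (RR * RR)) (f : RR * RR -> RR).
Proof.
move=> oW cf; apply: (measurability _ (RGenOpens.measurableE R)).
move=> _ [_ [a [b ->] <-]].
apply: open_measurable2; rewrite openE => x [Wx fx].
apply: filterI; first exact: open_nbhs_nbhs.
by apply: cf => //; apply: open_nbhs_nbhs; split => //; exact: interval_open.
Qed.

End openplane.

(** * Area of the image of a small box *)

Section local_estimate.
Context {R : realType}.
Notation RR := (measurableTypeR R).
Notation mu2 := (@lebesgue_measure R \x @lebesgue_measure R)%E.

Definition e1 : R * R := (1, 0).
Definition e2 : R * R := (0, 1).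

Definition det2 (f : R * R -> R * R) : R :=
  (f e1).1 * (f e2).2 - (f e2).1 * (f e1).2.

Lemma linear2E (f : {linear (R * R)%type -> (R * R)%type}) z : f z = z.1 *: f e1 + z.2 *: f e2.
Proof.
rewrite -!linearZ -linearD; congr (f _).
by apply: injective_projections; rewrite /= /GRing.scale/=; ring.
Qed.

Lemma linear2_bounded (f : {linear (R * R)%type -> (R * R)%type}) :
  exists2 C : R, 0 < C & forall z, `|f z| <= C * `|z|.
Proof.
exists (1 + `|f e1| + `|f e2|); first by rewrite -addrA ltr_pwDl// addr_ge0.
move=> z; rewrite linear2E (le_trans (ler_normD _ _))// !normrZ -addrA mulrDl mul1r.
have h1 : `|z.1| <= `|z| by rewrite prod_normE/= le_max lexx.
have h2 : `|z.2| <= `|z| by rewrite prod_normE/= le_max lexx orbT.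
rewrite ler_wpDl// mulrDl lerD// mulrC ler_wpM2l//.
Qed.

Lemma det2_mul (f g : {linear (R * R)%type -> (R * R)%type}) :
  (forall z, f (g z) = z) -> det2 f * det2 g = 1.
Proof.
move=> fg; rewrite /det2.
have h1 := congr1 fst (fg e1); have h2 := congr1 snd (fg e1).
have h3 := congr1 fst (fg e2); have h4 := congr1 snd (fg e2).
move: h1 h2 h3 h4; rewrite (linear2E f (g e1)) (linear2E f (g e2)).
rewrite /= /GRing.scale/= => h1 h2 h3 h4.
transitivity (((g e1).1 * (f e1).1 + (g e1).2 * (f e2).1) *
              ((g e2).1 * (f e1).2 + (g e2).2 * (f e2).2) -
              ((g e2).1 * (f e1).1 + (g e2).2 * (f e2).1) *
              ((g e1).1 * (f e1).2 + (g e1).2 * (f e2).2)); first by ring.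
by rewrite h1 h2 h3 h4; ring.
Qed.

Lemma lebesgue2_linear_preimage (f : {linear (R * R)%type -> (R * R)%type}) (x0 y0 : R * R) (a b c d : R) :
  det2 f != 0 -> a <= b -> c <= d ->
  mu2 [set z | ocbox a b c d (x0 + f (z - y0))] =
  (`|det2 f|^-1 * ((b - a) * (d - c)))%:E /\
  measurable ([set z | ocbox a b c d (x0 + f (z - y0))] : set (RR * RR)).
Proof.
move=> D0 ab cd.
have -> : [set z | ocbox a b c d (x0 + f (z - y0))] =
  [set z | `]a, b]%classic (aff2 (f e1).1 (f e2).1
              (x0.1 - (f e1).1 * y0.1 - (f e2).1 * y0.2) z) /\
           `]c, d]%classic (aff2 (f e1).2 (f e2).2
              (x0.2 - (f e1).2 * y0.1 - (f e2).2 * y0.2) z)].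
  apply/seteqP; split => z /=; rewrite /ocbox/= (linear2E f (z - y0)) /aff2/= => -[h1 h2];
  (split; [move: h1|move: h2]);
   match goal with |- is_true (?x \in _) -> is_true (?y \in _) => suff -> : x = y by [] end;
   rewrite /GRing.scale/=; ring.
split; last by apply: measurable_preimage2; exact: measurable_itv.
have := @lebesgue2_affine_preimage R (f e1).1 (f e2).1
              (x0.1 - (f e1).1 * y0.1 - (f e2).1 * y0.2)
     (f e1).2 (f e2).2
     (x0.2 - (f e1).2 * y0.1 - (f e2).2 * y0.2) _ _
     (measurable_itv (Interval (BRight a) (BRight b))) (measurable_itv (Interval (BRight c) (BRight d))) D0.
move=> ->; rewrite !lebesgue_measure_itv/= !lte_fin.
have itvE (u v : R) : u <= v -> (if (u < v)%R then v%:E - u%:E else 0)%E = (v - u)%R%:E.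
  by rewrite le_eqVlt => /orP[/eqP ->|->//]; rewrite ltxx subrr.
by rewrite !itvE.
Qed.

(** Lengthening or shortening both sides of a box by the relative amount [d] changes its area by a
    factor between 1 - k and 1 + k; the bound 1/2 keeps the shortened box from degenerating. *)
Lemma sqr_perturbation (k : R) : 0 < k ->
  exists2 d : R, 0 < d <= 2^-1 & (1 + d) ^+ 2 <= 1 + k /\ 1 - k <= (1 - d) ^+ 2.
Proof.
move=> k0; exists (Num.min 2^-1 (k / 3)).
  by rewrite lt_min ge_min lexx invr_gt0 ltr0n divr_gt0.
set d := Num.min _ _.
have d0 : 0 < d by rewrite lt_min invr_gt0 ltr0n divr_gt0.
have d1 : d <= 2^-1 by rewrite ge_min lexx.
have d2 : d <= k / 3 by rewrite ge_min lexx orbT.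
by split; nra.
Qed.

(* The image of a small box Q lies between two parallelograms, the images by the
   affine approximation of T at x0 of boxes slightly smaller and slightly larger
   than Q: the outer inclusion is the differentiability of T at x0, the inner one
   that of S at T x0. *)
Lemma local_estimate (A V : set (R * R)) (T S : R * R -> R * R) :
  (forall x, A x -> V (T x) /\ S (T x) = x) ->
  (forall y, V y -> A (S y) /\ T (S y) = y) ->
  open V ->
  (forall a b c d, measurable (V `&` S @^-1` ocbox a b c d : set (RR * RR))) ->
  forall (x0 : R * R) (L M : {linear (R * R)%type -> (R * R)%type}) (w h k : R),
  A x0 -> 0 < w -> 0 < h -> 0 < k ->
  (forall z, L (M z) = z) -> (forall z, M (L z) = z) ->
  (forall e, 0 < e -> \forall x \near x0, `|T x - T x0 - L (x - x0)| <= e * `|x - x0|) ->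
  (forall e, 0 < e ->
    \forall y \near T x0, `|S y - x0 - M (y - T x0)| <= e * `|y - T x0|) ->
  exists2 d, 0 < d & forall t a c, 0 < t < d ->
    ccbox a (a + w * t) c (c + h * t) x0 ->
    ocbox a (a + w * t) c (c + h * t) `<=` A ->
    ((`|det2 L| * (1 - k) * (w * t * (h * t)))%:E <=
     mu2 (V `&` S @^-1` ocbox a (a + w * t) c (c + h * t)) <=
     (`|det2 L| * (1 + k) * (w * t * (h * t)))%:E)%E.
Proof.
move=> TA SV oV mSbox x0 L M w h k Ax0 w0 h0 k0 LM ML dT dS.
have [d /andP[d0 d12] [dk1 dk2]] := sqr_perturbation _ k0.
have [C1 C10 LC] := linear2_bounded L.
have [C2 C20 MC] := linear2_bounded M.
have detLM := det2_mul _ _ LM.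
have detM0 : det2 M != 0.
  by apply/eqP => h'; move/eqP: detLM; rewrite h' mulr0 eq_sym oner_eq0.
have detE : `|det2 M|^-1 = `|det2 L|.
  by apply: (mulIf (x := `|det2 M|)); rewrite ?normr_eq0// mulVf ?normr_eq0// -normrM detLM normr1.
pose m := Num.max w h.
have m0 : 0 < m by rewrite lt_max w0.
have wm : w <= m by rewrite le_max lexx.
have hm : h <= m by rewrite le_max lexx orbT.
(* A displacement of size at most r t stays within the margins d w t / 2 and d h t / 2 by which each
   end of the sides is moved. *)
pose r := d * Num.min w h / 2.
have r0 : 0 < r by rewrite divr_gt0// mulr_gt0// lt_min w0.
have rw : r <= d * w / 2 by rewrite ler_pM2r// ler_pM2l// ge_min lexx.
have rh : r <= d * h / 2 by rewrite ler_pM2r// ler_pM2l// ge_min lexx orbT.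
(* Points of the box are within t m of [x0], so the error of [T] is at most r t / C2, and at most r
   t once [M] is applied. Likewise |L u| <= C1 t m for |u| <= t m, so the error of [S] is at most r
   t. *)
have /nbhs_ballP[d1 /= d10 near1] := dT (r / (C2 * m)) (divr_gt0 r0 (mulr_gt0 C20 m0)).
have /nbhs_ballP[d2 /= d20 near2] := dS (r / (C1 * m)) (divr_gt0 r0 (mulr_gt0 C10 m0)).
have /nbhs_ballP[d3 /= d30 near3] : nbhs (T x0) V.
  by apply: open_nbhs_nbhs; split => //; case: (TA _ Ax0).
pose dd := Num.min (d1 / m) (Num.min (d2 / (C1 * m)) (d3 / (C1 * m))).
exists dd; first by rewrite !lt_min !divr_gt0// mulr_gt0.
move=> t a c /andP[t0]; rewrite !lt_min => /and3P[t1 t2 t3].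
rewrite ltr_pdivlMr// in t1; rewrite ltr_pdivlMr ?mulr_gt0// in t2.
rewrite ltr_pdivlMr ?mulr_gt0// in t3.
move=> [] /=; rewrite !in_itv/= => /andP[ax xa] /andP[cx xc] QA.
have wt0 : 0 < w * t by rewrite mulr_gt0.
have ht0 : 0 < h * t by rewrite mulr_gt0.
have rt0 : 0 < r * t by rewrite mulr_gt0.
have rwt : r * t <= d * (w * t) / 2 by have := ler_wpM2r (ltW t0) rw; clear; lra.
have rht : r * t <= d * (h * t) / 2 by have := ler_wpM2r (ltW t0) rh; clear; lra.
have wtm : w * t <= t * m by rewrite mulrC ler_pM2l.
have htm : h * t <= t * m by rewrite mulrC ler_pM2l.
have normP (z : R * R) (e : R) : `|z| <= e <-> (- e <= z.1 <= e /\ - e <= z.2 <= e).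
  rewrite prod_normE/= ge_max !ler_norml; split; first by move=> /andP[].
  by move=> [-> ->].
have [EpE mEp] := lebesgue2_linear_preimage M x0 (T x0) (a - d * (w * t) / 2) (a + w * t + d * (w * t) / 2)
   (c - d * (h * t) / 2) (c + h * t + d * (h * t) / 2) detM0 ltac:(nra) ltac:(nra).
have [EmE mEm] := lebesgue2_linear_preimage M x0 (T x0) (a + d * (w * t) / 2) (a + w * t - d * (w * t) / 2)
   (c + d * (h * t) / 2) (c + h * t - d * (h * t) / 2) detM0 ltac:(nra) ltac:(nra).
apply/andP; split.
- apply: (@le_trans _ _ (mu2 [set z | ocbox (a + d * (w * t) / 2) (a + w * t - d * (w * t) / 2)
   (c + d * (h * t) / 2) (c + h * t - d * (h * t) / 2) (x0 + M (z - T x0))])).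
    rewrite EmE lee_fin detE -mulrA ler_wpM2l//.
    have := ler_wpM2r (ltW (mulr_gt0 wt0 ht0)) dk2.
    move=> /le_trans; apply; clear; lra.
  apply: le_measure; [by rewrite inE; exact: mEm|by rewrite inE; exact: mSbox|].
  move=> z [] /=; rewrite !in_itv/= => /andP[z1 z2] /andP[z3 z4].
  set u := M (z - T x0) in z1 z2 z3 z4.
  have uE : z - T x0 = L u by rewrite LM.
  have un : `|u| <= t * m.
    clearbody u; clear -normP z1 z2 z3 z4 ax xa cx xc wtm htm rwt rht rt0.
    by apply/normP; move: z1 z2 z3 z4 => /= z1 z2 z3 z4; split; apply/andP; split; lra.
  have zn : `|z - T x0| <= t * (C1 * m).
    rewrite uE (le_trans (LC _))// mulrCA ler_wpM2l// ltW//.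
  have Vz : V z.
    by apply: near3; rewrite -ball_normE/= distrC (le_lt_trans zn).
  split=> //.
  have : `|S z - x0 - u| <= r * t.
    have : ball (T x0) d2 z by rewrite -ball_normE/= distrC (le_lt_trans zn).
    move=> /near2/= /le_trans; apply.
    have e0 : 0 <= r / (C1 * m) by rewrite ltW// divr_gt0// mulr_gt0.
    apply: (le_trans (ler_wpM2l e0 zn)); rewrite le_eqVlt; apply/orP; left; apply/eqP.
    by field; rewrite !gt_eqF.
  move=> /normP/= [/andP[k1 k2] /andP[k3 k4]]; move: z1 z2 z3 z4 => /= z1 z2 z3 z4.
  clear -k1 k2 k3 k4 z1 z2 z3 z4 rwt rht.
  by split; rewrite /= in_itv/=; apply/andP; split; lra.
- apply: (@le_trans _ _ (mu2 [set z | ocbox (a - d * (w * t) / 2) (a + w * t + d * (w * t) / 2)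
   (c - d * (h * t) / 2) (c + h * t + d * (h * t) / 2) (x0 + M (z - T x0))])); last first.
    rewrite EpE lee_fin detE -[leRHS]mulrA ler_wpM2l//.
    have := ler_wpM2r (ltW (mulr_gt0 wt0 ht0)) dk1.
    apply: le_trans; clear; lra.
  apply: le_measure; [by rewrite inE; exact: mSbox|by rewrite inE; exact: mEp|].
  move=> z [Vz Qz] /=.
  have [_ TSz] := SV _ Vz.
  set x := S z in TSz Qz.
  have [/andP[z1 z2] /andP[z3 z4]] : (a < x.1 <= a + w * t) /\ (c < x.2 <= c + h * t).
    by case: Qz => /=; rewrite !in_itv.
  have xn : `|x - x0| <= t * m.
    clearbody x; clear -normP z1 z2 z3 z4 ax xa cx xc wtm htm.
    by apply/normP; split; apply/andP; split => /=; lra.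
  have : `|M (z - T x0) - (x - x0)| <= r * t.
    (* As [M] inverts [L], the difference is [M] applied to the error term T x - T x0 - L (x -
       x0). *)
    rewrite -[X in _ - X]ML -linearB (le_trans (MC _))//.
    have : ball x0 d1 x by rewrite -ball_normE/= distrC (le_lt_trans xn).
    move=> /near1/=; rewrite TSz => h'.
    rewrite (le_trans (ler_wpM2l (ltW C20) h'))//.
    have e0 : 0 <= r / (C2 * m) by rewrite ltW// divr_gt0// mulr_gt0.
    apply: (le_trans (ler_wpM2l (ltW C20) (ler_wpM2l e0 xn))).
    rewrite le_eqVlt; apply/orP; left; apply/eqP.
    by field; rewrite !gt_eqF.
  move=> /normP/= [/andP[k1 k2] /andP[k3 k4]].
  clear -k1 k2 k3 k4 z1 z2 z3 z4 rwt rht.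
  by split; rewrite /= in_itv/=; apply/andP; split; lra.
Qed.

End local_estimate.

(** * Goursat's bisection *)

Section bisection.
Context {R : realType}.

Lemma nested_segments (a b : nat -> R) :
  (forall n, a n <= a n.+1) -> (forall n, b n.+1 <= b n) -> (forall n, a n <= b n) ->
  exists x, forall n, a n <= x <= b n.
Proof.
move=> /nondecreasing_seqP nda /nonincreasing_seqP nib ab.
have amb m n : a m <= b n.
  by rewrite (le_trans (nda _ _ (leq_maxl m n)))// (le_trans (ab _))// nib// leq_maxr.
exists (sup (range a)) => n; apply/andP; split.
  by apply: ub_le_sup; [exists (b 0%N) => _ [m _ <-]|exists n].
by apply: ge_sup; [exists (a 0%N), 0%N|move=> _ [m _ <-]].
Qed.

(** All boxes keep the proportions w : h of the first one, so the scale [t] is their only size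
    parameter, and a local property stated for fixed [w] and [h] applies to the whole nested
    sequence. *)
Lemma box_bisection (P : R -> R -> R -> Prop) (w h a0 c0 t0 : R) :
  0 < w -> 0 < h -> 0 < t0 ->
  (forall a c t, 0 < t -> P a c (t / 2) -> P (a + w * (t / 2)) c (t / 2) ->
     P a (c + h * (t / 2)) (t / 2) -> P (a + w * (t / 2)) (c + h * (t / 2)) (t / 2) ->
     P a c t) ->
  (forall x, ccbox a0 (a0 + w * t0) c0 (c0 + h * t0) x -> exists2 d, 0 < d &
     forall a c t, 0 < t < d -> ccbox a (a + w * t) c (c + h * t) x ->
      a0 <= a -> a + w * t <= a0 + w * t0 -> c0 <= c -> c + h * t <= c0 + h * t0 ->
      P a c t) ->
  P a0 c0 t0.
Proof.
move=> w0 h0 t00 Psplit Ploc; apply: contrapT => nP.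
(* The relation constrains only boxes of positive scale where [P] fails; any successor serves for
   the others, which makes choice applicable to all triples. *)
pose child (s s' : R * R * R) := 0 < s.2 -> ~ P s.1.1 s.1.2 s.2 ->
  [/\ ~ P s'.1.1 s'.1.2 s'.2, s'.2 = s.2 / 2,
      s.1.1 <= s'.1.1 <= s.1.1 + w * (s.2 / 2) &
      s.1.2 <= s'.1.2 <= s.1.2 + h * (s.2 / 2)].
have /choice[f childf] : forall s, exists s', child s s'.
  move=> [[a c] t]; apply: contrapT => noch.
  have [t_gt0|/negP t_le0] := boolP (0 < t); last first.
    by apply: noch; exists (a, c, t) => t_gt0; case: t_le0.
  have wt : 0 <= w * (t / 2) by rewrite mulr_ge0// ltW// divr_gt0.
  have ht : 0 <= h * (t / 2) by rewrite mulr_ge0// ltW// divr_gt0.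
  have [Pt|nPt] := pselect (P a c t); first by apply: noch; exists (a, c, t).
  apply: nPt; apply: Psplit => //; apply: contrapT => nPt;
    apply: noch.
  - by exists (a, c, t / 2) => _ _ /=; split => //; rewrite ?lexx lerDl ?wt ?ht.
  - by exists (a + w * (t / 2), c, t / 2) => _ _ /=; split => //; rewrite ?lexx lerDl ?wt ?ht.
  - by exists (a, c + h * (t / 2), t / 2) => _ _ /=; split => //; rewrite ?lexx lerDl ?wt ?ht.
  - by exists (a + w * (t / 2), c + h * (t / 2), t / 2) => _ _ /=; split => //; rewrite ?lexx lerDl ?wt ?ht.
pose s n := iter n f (a0, c0, t0).
have sP n : [/\ ~ P (s n).1.1 (s n).1.2 (s n).2 & (s n).2 = t0 / 2 ^+ n].
  elim: n => [|n [IH1 IH2]]; first by rewrite /= expr0 divr1.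
  have tn : 0 < (s n).2 by rewrite IH2 divr_gt0// exprn_gt0.
  have [h1 h2 _ _] := childf (s n) tn IH1.
  split; first exact: h1.
  by rewrite [LHS]h2 IH2 -mulrA -invfM -exprSr.
have tn n : 0 < (s n).2 by have [_ ->] := sP n; rewrite divr_gt0// exprn_gt0.
have sch n : [/\ (s n).1.1 <= (s n.+1).1.1, (s n).1.2 <= (s n.+1).1.2,
   (s n.+1).1.1 + w * (s n.+1).2 <= (s n).1.1 + w * (s n).2 &
   (s n.+1).1.2 + h * (s n.+1).2 <= (s n).1.2 + h * (s n).2].
  have [nPn _] := sP n.
  have [_ h2 /andP[h3 h4] /andP[h5 h6]] := childf (s n) (tn n) nPn.
  by split; rewrite ?h3 ?h5 //= -/(s n) h2; move: h4 h6 => /=; lra.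
have [x hx] : exists x, forall n, (s n).1.1 <= x <= (s n).1.1 + w * (s n).2.
  apply: nested_segments => n; try by have [] := sch n.
  by rewrite lerDl ltW// mulr_gt0.
have [y hy] : exists x, forall n, (s n).1.2 <= x <= (s n).1.2 + h * (s n).2.
  apply: nested_segments => n; try by have [] := sch n.
  by rewrite lerDl ltW// mulr_gt0.
have [] := Ploc (x, y).
  by split => /=; rewrite in_itv/=; [exact: (hx 0%N)|exact: (hy 0%N)].
move=> d d0 Pd.
have [n nd] : exists n, t0 / 2 ^+ n < d.
  exists (Num.bound (t0 / d)); rewrite ltr_pdivrMr ?exprn_gt0// mulrC -ltr_pdivrMr//.
  have td : 0 <= t0 / d by rewrite divr_ge0 ?ltW.
  apply: (lt_le_trans (archi_boundP td)).
  by rewrite -natrX ler_nat ltnW// ltn_expl.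
have [nPn tE] := sP n; apply: nPn; apply: Pd.
- by rewrite tn tE.
- by split => /=; rewrite in_itv/=.
- by elim: (n) => // k IH; rewrite (le_trans IH)//; have [] := sch k.
- by elim: (n) => // k IH; rewrite (le_trans _ IH)//; have [] := sch k.
- by elim: (n) => // k IH; rewrite (le_trans IH)//; have [] := sch k.
- by elim: (n) => // k IH; rewrite (le_trans _ IH)//; have [] := sch k.
Qed.

End bisection.

(** * Densities, and measures determined by boxes *)

Section density.
Context d (T : measurableType d) (R : realType) (mu : {measure set T -> \bar R}).
Variable f : T -> \bar R.
Hypotheses (mf : measurable_fun setT f) (f0 : forall x, (0 <= f x)%E).

Lemma density_measure :
  exists m : {measure set T -> \bar R}, forall A, m A = (\int[mu]_(x in A) f x)%E.
Proof.
pose m (A : set T) := (\int[mu]_(x in A) f x)%E.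
have m0 : m set0 = 0%E by rewrite /m integral_set0.
have m_ge0 A : (0 <= m A)%E by exact: integral_ge0.
have ms : semi_sigma_additive m.
  exact: semi_sigma_additive_nng_induced.
pose mM := isMeasure.Build _ _ _ m m0 m_ge0 ms.
pose mm : {measure set T -> \bar R} := HB.pack m mM.
by exists mm.
Qed.
End density.

Section boxes.
Context {R : realType}.
Notation RR := (measurableTypeR R).

Definition ocboxes : set (set (R * R)) :=
  [set Q | exists a b c d, Q = ocbox a b c d].

Lemma itv_cover : \bigcup_n `]- n%:R, n%:R] = [set: R].
Proof.
apply/seteqP; split => // x _; exists (Num.bound `|x|) => //=.
have := archi_boundP (normr_ge0 x); rewrite in_itv/= ltr_norml => /andP[-> /ltW ->].
by [].
Qed.

(** The product sigma-algebra is the smallest one for which both projections are measurable. The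
    preimage of a half-open interval by a projection is a strip, that is, a countable union of
    boxes. *)
Lemma measurable_ocboxes (X : set (RR * RR)) : measurable X -> <<s ocboxes >> X.
Proof.
apply: smallest_sub; first exact: smallest_sigma_algebra.
pose G : measurableType _ := g_sigma_algebraType ocboxes.
have m1 : measurable_fun setT (fst : G -> RR).
  apply: (measurability (@ocitv R) (erefl _)) => _ [_ [[a b] _ <-] <-].
  rewrite setTI (_ : _ @^-1` _ = \bigcup_n ocbox a b (- n%:R) n%:R).
    by apply: bigcup_measurable => n _; apply: sub_sigma_algebra; exists a, b, (- n%:R), n%:R.
  apply/seteqP; split => [[x y] /= xab|[x y] [n _ []] //].
  have : setT y by [].
  by rewrite -itv_cover => -[n _ yn]; exists n.
have m2 : measurable_fun setT (snd : G -> RR).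
  apply: (measurability (@ocitv R) (erefl _)) => _ [_ [[a b] _ <-] <-].
  rewrite setTI (_ : _ @^-1` _ = \bigcup_n ocbox (- n%:R) n%:R a b).
    by apply: bigcup_measurable => n _; apply: sub_sigma_algebra; exists (- n%:R), n%:R, a, b.
  apply/seteqP; split => [[x y] /= xab|[x y] [n _ []] //].
  have : setT x by [].
  by rewrite -itv_cover => -[n _ yn]; exists n.
by move=> Y [[Z mZ <-]|[Z mZ <-]]; [exact: m1|exact: m2].
Qed.

Lemma ocbox_setI : setI_closed ocboxes.
Proof.
move=> _ _ [a [b [c [d ->]]]] [a' [b' [c' [d' ->]]]].
exists (Num.max a a'), (Num.min b b'), (Num.max c c'), (Num.min d d').
apply/seteqP; split => -[x y]; rewrite /ocbox/= !in_itv/= !gt_max !le_min.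
  by move=> [[/andP[-> ->] /andP[-> ->]] [/andP[-> ->] /andP[-> ->]]].
by move=> [/andP[/andP[-> ->] /andP[-> ->]] /andP[/andP[-> ->] /andP[-> ->]]].
Qed.

End boxes.

Section measures_on_boxes.
Context {R : realType}.
Notation RR := (measurableTypeR R).

Lemma measure_ocbox_splitl (m : {measure set (RR * RR) -> \bar R}) (a e b c d : R) :
  a <= e <= b -> m (ocbox a b c d) = (m (ocbox a e c d) + m (ocbox e b c d))%E.
Proof.
move=> /andP[ae eb]; rewrite -measureU; try exact: measurable_ocbox; last first.
  apply/seteqP; split => // -[x y] [[/= + _] [/= + _]]; rewrite !in_itv/=.
  by move=> /andP[_ xe] /andP[ex _]; rewrite ltNge xe in ex.
congr (m _); apply/seteqP; split => -[x y] /=; rewrite /ocbox/= !in_itv/=.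
  by move=> [/andP[ax xb] ->]; case: (leP x e) => xe; [left|right]; rewrite ?ax ?xb.
move=> [] [/andP[x1 x2] ->]; split => //; apply/andP; split => //.
  exact: le_trans eb.
exact: le_lt_trans x1.
Qed.

Lemma measure_ocbox_splitr (m : {measure set (RR * RR) -> \bar R}) (a b c e d : R) :
  c <= e <= d -> m (ocbox a b c d) = (m (ocbox a b c e) + m (ocbox a b e d))%E.
Proof.
move=> /andP[ae eb]; rewrite -measureU; try exact: measurable_ocbox; last first.
  apply/seteqP; split => // -[x y] [[/= _ +] [/= _ +]]; rewrite !in_itv/=.
  by move=> /andP[_ xe] /andP[ex _]; rewrite ltNge xe in ex.
congr (m _); apply/seteqP; split => -[x y] /=; rewrite /ocbox/= !in_itv/=.
  by move=> [-> /andP[ax xb]]; case: (leP y e) => xe; [left|right]; rewrite ?ax ?xb.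
move=> [] [-> /andP[x1 x2]]; split => //; apply/andP; split => //.
  exact: le_trans eb.
exact: le_lt_trans x1.
Qed.

(* Both sides of the local inequality are additive, so if it fails for a box it
   fails for one of its quarters. *)
Lemma measure_le_ocbox (m1 m2 : {measure set (RR * RR) -> \bar R}) (W : set (R * R)) :
  (forall x w h k, W x -> 0 < w -> 0 < h -> 0 < k -> exists2 e, 0 < e &
    forall t a c, 0 < t < e -> ccbox a (a + w * t) c (c + h * t) x ->
      ocbox a (a + w * t) c (c + h * t) `<=` W ->
      (m1 (ocbox a (a + w * t) c (c + h * t)) <=
       m2 (ocbox a (a + w * t) c (c + h * t)) + (k * (w * t * (h * t)))%:E)%E) ->
  forall a b c d, a < b -> c < d -> ccbox a b c d `<=` W ->
    (m1 (ocbox a b c d) <= m2 (ocbox a b c d))%E.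
Proof.
move=> loc a b c d ab cd QW; apply/lee_addgt0Pr => k k0.
pose w := b - a; pose h := d - c.
have w0 : 0 < w by rewrite subr_gt0.
have h0 : 0 < h by rewrite subr_gt0.
pose Q a c t := ocbox a (a + w * t) c (c + h * t).
have wb : a + w * 1 = b by rewrite mulr1 addrC subrK.
have hd : c + h * 1 = d by rewrite mulr1 addrC subrK.
have wh0 : 0 < w * h by rewrite mulr_gt0.
(* The error [k] is spread in proportion to area, so that four quarters together get the share of
   the whole box. *)
pose k' := k / (w * h).
have k'0 : 0 < k' by rewrite divr_gt0.
suff : (m1 (Q a c 1%R) <= m2 (Q a c 1%R) + (k' * (w * 1 * (h * 1)))%:E)%E.
  by rewrite /Q wb hd !mulr1 /k' divfK ?gt_eqF.
apply: (@box_bisection R (fun a c t =>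
   m1 (Q a c t) <= m2 (Q a c t) + (k' * (w * t * (h * t)))%:E)%E w h a c 1) => //.
- move=> a1 c1 t t0 P1 P2 P3 P4.
  have w2 : 0 <= w * (t / 2) by rewrite mulr_ge0// ?divr_ge0// ltW.
  have h2 : 0 <= h * (t / 2) by rewrite mulr_ge0// ?divr_ge0// ltW.
  have wE : a1 + w * t = a1 + w * (t / 2) + w * (t / 2) by field.
  have hE : c1 + h * t = c1 + h * (t / 2) + h * (t / 2) by field.
  have split4 (m : {measure set (RR * RR) -> \bar R}) : m (Q a1 c1 t) =
     ((m (Q a1 c1 (t / 2)%R) + m (Q a1 (c1 + h * (t / 2))%R (t / 2)%R)) +
     (m (Q (a1 + w * (t / 2))%R c1 (t / 2)%R) +
      m (Q (a1 + w * (t / 2))%R (c1 + h * (t / 2))%R (t / 2)%R)))%E.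
    rewrite /Q (@measure_ocbox_splitl _ _ (a1 + w * (t / 2))); last first.
      by rewrite wE !lerDl w2.
    rewrite (@measure_ocbox_splitr _ _ _ _ (c1 + h * (t / 2))); last first.
      by rewrite hE !lerDl h2.
    rewrite (@measure_ocbox_splitr _ (a1 + w * (t / 2)) _ _ (c1 + h * (t / 2))); last first.
      by rewrite hE !lerDl h2.
    by rewrite wE hE.
  rewrite !split4; apply: (le_trans (leeD (leeD P1 P3) (leeD P2 P4))).
  rewrite (_ : k' * (w * t * (h * t)) = k' * (w * (t / 2) * (h * (t / 2))) +
     k' * (w * (t / 2) * (h * (t / 2))) + (k' * (w * (t / 2) * (h * (t / 2))) +
     k' * (w * (t / 2) * (h * (t / 2))))); last by field.
  set K := k' * (w * (t / 2) * (h * (t / 2))).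
  have sumE (x1 x2 x3 x4 : \bar R) : (x1 + K%:E + (x2 + K%:E) + (x3 + K%:E + (x4 + K%:E)) =
      x1 + x2 + (x3 + x4) + (K + K + (K + K))%:E)%E.
    by rewrite !EFinD (addeACA x1 K%:E x2) (addeACA x3 K%:E x4) (addeACA (x1 + x2)%E).
  by rewrite sumE.
- move=> x xQ.
  have Wx : W x.
    by apply: QW; move: xQ; rewrite wb hd.
  have [e e0 He] := loc x w h k' Wx w0 h0 k'0.
  exists e => // a' c' t te xq a'a ab' c'c cd'; apply: He => //.
  move=> [z1 z2] [] /=; rewrite !in_itv/= => /andP[z11 z12] /andP[z21 z22].
  rewrite wb in ab'; rewrite hd in cd'.
  apply: QW; clear -z11 z12 z21 z22 a'a c'c ab' cd'.
  by split; rewrite /= in_itv/=; apply/andP; split; lra.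
Qed.

(** Boxes inside [W] are not a generating family for the plane, so both measures are restricted to
    one box [Q n] of a countable cover of [W]. Intersecting any box with [Q n] gives a box whose
    closure is in [W], and uniqueness for finite measures on a pi-system applies. Making the cover
    disjoint then adds up the pieces of [X]. *)
Lemma eq_measure_ocboxes (m1 m2 : {measure set (RR * RR) -> \bar R}) (W : set (R * R)) :
  open W ->
  (forall a b c d, a < b -> c < d -> ccbox a b c d `<=` W ->
    (m1 (ocbox a b c d) = m2 (ocbox a b c d) /\ m1 (ocbox a b c d) < +oo)%E) ->
  forall X : set (RR * RR), measurable X -> X `<=` W -> m1 X = m2 X.
Proof.
move=> oW eqQ X mX XW.
have {}eqQ a b c d : ccbox a b c d `<=` W ->
    (m1 (ocbox a b c d) = m2 (ocbox a b c d) /\ m1 (ocbox a b c d) < +oo)%E.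
  have [ab|ba] := ltP a b; last first.
    rewrite (_ : ocbox a b c d = set0) ?measure0//.
    by rewrite /ocbox set_itv_ge ?set0X// -leNgt bnd_simp.
  have [cd|dc] := ltP c d; last first.
    rewrite (_ : ocbox a b c d = set0) ?measure0//.
    by rewrite /ocbox [X in _ `*` X]set_itv_ge ?setX0// -leNgt bnd_simp.
  exact: eqQ.
have [a [b [c [d [QW WE]]]]] := open_bigcup_boxes W oW.
pose Q n : set (RR * RR) := ocbox (a n) (b n) (c n) (d n).
have mQ n : measurable (Q n) by exact: measurable_ocbox.
have eqn n Y : measurable Y -> m1 (Y `&` Q n) = m2 (Y `&` Q n).
  move=> mY.
  pose r1 : {measure set (RR * RR) -> \bar R} :=
    measure_function_mrestr__canonical__measure_function_Measure m1 (mQ n).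
  pose r2 : {measure set (RR * RR) -> \bar R} :=
    measure_function_mrestr__canonical__measure_function_Measure m2 (mQ n).
  rewrite -[LHS]/(r1 Y) -[RHS]/(r2 Y).
  have sub a' b' c' d' : ocbox a' b' c' d' `&` Q n =
     ocbox (Num.max a' (a n)) (Num.min b' (b n)) (Num.max c' (c n)) (Num.min d' (d n)).
    apply/seteqP; split => -[x y]; rewrite /Q /ocbox/= !in_itv/= !gt_max !le_min.
      by move=> [[/andP[-> ->] /andP[-> ->]] [/andP[-> ->] /andP[-> ->]]].
    by move=> [/andP[/andP[-> ->] /andP[-> ->]] /andP[/andP[-> ->] /andP[-> ->]]].
  have subW a' b' c' d' :
      ccbox (Num.max a' (a n)) (Num.min b' (b n)) (Num.max c' (c n)) (Num.min d' (d n)) `<=` W.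
    move=> z [] /=; rewrite !in_itv/= !ge_max !le_min => /andP[/andP[_ z1] /andP[_ z2]].
    move=> /andP[/andP[_ z3] /andP[_ z4]]; apply: (QW n).
    by split; rewrite /= in_itv/= ?z1 ?z2 ?z3 ?z4.
  apply: (@g_sigma_algebra_measure_unique _ R (RR * RR)%type ocboxes _
      (fun n => ocbox (- n%:R) n%:R (- n%:R) n%:R)).
  - by move=> _ [? [? [? [? ->]]]]; exact: measurable_ocbox.
  - by move=> i; exists (- i%:R), i%:R, (- i%:R), i%:R.
  - apply/seteqP; split => // -[x y] _.
    exists (maxn (Num.bound `|x|) (Num.bound `|y|)) => //=.
    have := archi_boundP (normr_ge0 x); have := archi_boundP (normr_ge0 y).
    rewrite /ocbox/= !in_itv/= !ltr_norml => /andP[y1 y2] /andP[x1 x2].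
    have /= := leq_maxl (Num.bound `|x|) (Num.bound `|y|).
    have /= := leq_maxr (Num.bound `|x|) (Num.bound `|y|).
    rewrite -!(ler_nat R) => h1 h2.
    by split; apply/andP; split; lra.
  - exact: ocbox_setI.
  - move=> _ [a' [b' [c' [d' ->]]]] /=; rewrite /mrestr /= sub.
    by have [->] := eqQ _ _ _ _ (subW a' b' c' d').
  - move=> k /=; rewrite /mrestr /= sub.
    by have [] := eqQ _ _ _ _ (subW (- k%:R) k%:R (- k%:R) k%:R).
  - exact: measurable_ocboxes.
have XE : X = \bigcup_n (X `&` seqDU Q n).
  by rewrite -setI_bigcupr -seqDU_bigcup_eq -WE; exact/esym/setIidPl.
have mXD n : measurable (X `&` seqDU Q n) by apply: measurableI => //; exact: seqDU_measurable.
have tX : trivIset setT (fun n => X `&` seqDU Q n).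
  by apply: trivIset_setIl; exact: trivIset_seqDU.
have mU : measurable (\bigcup_n (X `&` seqDU Q n)) by rewrite -XE.
rewrite XE !measure_semi_bigcup//; apply: eq_eseriesr => n _.
have -> : X `&` seqDU Q n = (X `&` seqDU Q n) `&` Q n.
  by rewrite -setIA; congr setI; apply/esym/setIidPl; exact: subset_seqDU.
exact: eqn.
Qed.

End measures_on_boxes.

(** * Differentials of inverse maps, and continuous densities *)

Section differentials.
Context {R : realType}.

Lemma differentiable_eps (K : numFieldType) (V W : normedModType K) (f : V -> W) (x : V) (e : K) :
  differentiable f x -> 0 < e ->
  \forall y \near x, `|f y - f x - 'd f x (y - x)| <= e * `|y - x|.
Proof.
move=> /diff_locallyP[_ /eqaddoP df] e0.
have /nbhs_ballP[d /= d0 Hd] := df e e0.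
apply/nbhs_ballP; exists d => //= y; rewrite -ball_normE/= => xy.
have := Hd (y - x); rewrite -ball_normE/= sub0r normrN distrC => /(_ xy).
by rewrite !fctE /= subrK opprD addrA.
Qed.

Lemma diff_cancel (f g : R * R -> R * R) (x : R * R) :
  differentiable f x -> differentiable g (f x) ->
  (\forall y \near x, g (f y) = y) -> forall v, 'd g (f x) ('d f x v) = v.
Proof.
move=> df dg gf v.
have dgf : differentiable (g \o f) x by exact: differentiable_comp.
transitivity ('D_v (g \o f) x).
  have dE := deriveE v dgf.
  have cE := congr1 (fun h => h v) (diff_comp df dg).
  apply: etrans (esym dE).
  exact: (esym cE).
by rewrite (near_eq_derive v gf) derive_id.
Qed.

End differentials.

Section continuous_density.
Context {R : realType}.
Notation RR := (measurableTypeR R).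
Notation mu2 := (@lebesgue_measure R \x @lebesgue_measure R)%E.

Lemma mu2_ocbox (a b c d : R) : a <= b -> c <= d ->
  mu2 (ocbox a b c d) = ((b - a) * (d - c))%:E.
Proof.
move=> ab cd; rewrite /ocbox product_measure1E; [|exact: measurable_itv..].
rewrite /= !lebesgue_measure_itv/= !lte_fin.
have itvE (u v : R) : u <= v -> (if (u < v)%R then v%:E - u%:E else 0)%E = (v - u)%R%:E.
  by rewrite le_eqVlt => /orP[/eqP ->|->//]; rewrite ltxx subrr.
by rewrite !itvE.
Qed.

(** The map is made constant outside [W], since a pushforward measure requires a map measurable on
    the whole plane. *)
Lemma measurable_continuous_restrict (W : set (R * R)) (f : R * R -> R * R) :
  open W -> (forall x, W x -> {for x, continuous f}) ->
  measurable_fun [set: RR * RR]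
    (fun y => ((fst \o f) \_ W y, (snd \o f) \_ W y) : RR * RR).
Proof.
move=> oW cf; have mW := open_measurable2 _ oW.
have c1 x : W x -> {for x, continuous (fun y => (f y).1)}.
  by move=> Wx; apply: continuous_comp; [exact: cf|exact: cvg_fst].
have c2 x : W x -> {for x, continuous (fun y => (f y).2)}.
  by move=> Wx; apply: continuous_comp; [exact: cf|exact: cvg_snd].
have m1 := (measurable_restrictT _ mW).1 (continuous_measurable2 _ _ oW c1).
have m2 := (measurable_restrictT _ mW).1 (continuous_measurable2 _ _ oW c2).
exact: (measurable_fun_pair m1 m2).
Qed.

Lemma measurable_preimage_continuous (W : set (R * R)) (f : R * R -> R * R) :
  open W -> (forall x, W x -> {for x, continuous f}) ->
  forall X : set (RR * RR), measurable X -> measurable (W `&` f @^-1` X : set (RR * RR)).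
Proof.
move=> oW cf X mX.
have mW := open_measurable2 _ oW.
pose f0 (y : RR * RR) : RR * RR := ((fst \o f) \_ W y, (snd \o f) \_ W y).
have mf0 : measurable_fun setT f0 by exact: measurable_continuous_restrict.
rewrite (_ : W `&` f @^-1` X = W `&` f0 @^-1` X).
  by apply: measurableI => //; rewrite -[X in measurable X]setTI; exact: mf0.
have f0E x : W x -> f0 x = f x by move=> Wx; rewrite /f0 !patchE mem_set//=; case: (f x).
by apply/seteqP; split => x [Wx] /=; rewrite f0E.
Qed.

Variables (A : set (R * R)) (J : R * R -> R).
Hypothesis oA : open A.
Hypothesis cJ : forall x, A x -> {for x, continuous J}.
Hypothesis J0 : forall x, A x -> 0 <= J x.

Definition restrJ (x : RR * RR) : \bar R := ((fun x => (J x)%:E) \_ A) x.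

Lemma restrJE x : A x -> restrJ x = (J x)%:E.
Proof. by move=> Ax; rewrite /restrJ patchE mem_set. Qed.

Let mJ : measurable_fun (A : set (RR * RR)) (fun x => (J x)%:E).
Proof. by apply/measurable_EFinP; exact: continuous_measurable2. Qed.

Lemma measurable_restrJ : measurable_fun [set: RR * RR] restrJ.
Proof.
have mA := open_measurable2 _ oA.
exact: ((measurable_restrictT _ mA).1 mJ).
Qed.

Lemma restrJ_ge0 x : (0 <= restrJ x)%E.
Proof.
rewrite /restrJ patchE; case: ifPn => // /set_mem Ax.
by rewrite lee_fin J0.
Qed.

Definition nuJ (Q : set (RR * RR)) := (\int[mu2]_(x in Q) restrJ x)%E.

Lemma nuJE Q : Q `<=` A -> nuJ Q = (\int[mu2]_(x in Q) (J x)%:E)%E.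
Proof. by move=> QA; apply: eq_integral => x /set_mem Qx; rewrite restrJE//; exact: QA. Qed.

Let mJQ (Q : set (RR * RR)) : Q `<=` A -> measurable_fun Q (fun x => (J x)%:E).
Proof. by move=> QA; apply: measurable_funS mJ => //; exact: open_measurable2. Qed.

(** By continuity [J] stays within [k] of J x on a small ball. The lower bound has [k] on the larger
    side because J x - k may be negative and extended reals are better not subtracted. *)
Lemma nuJ_bound (x : R * R) (k : R) : A x -> 0 < k -> \forall d \near 0^'+,
  forall Q : set (RR * RR), measurable Q -> Q `<=` ball x d -> Q `<=` A ->
  (nuJ Q <= (J x + k)%:E * mu2 Q /\ (J x)%:E * mu2 Q <= nuJ Q + k%:E * mu2 Q)%E.
Proof.
move=> Ax k0.
have /cvgrPdist_lt/(_ k k0)/nbhs_ballP[e /= e0 He] : J y @[y --> x] --> J x by exact: cJ.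
near=> d => Q mQ Qd QA.
have Qe z : Q z -> `|J x - J z| < k.
  move=> /Qd xz; apply: He; apply: le_ball xz; near: d.
  exact: nbhs_right_le.
have mJQ' := mJQ Q QA.
have JQ0 z : Q z -> (0 <= (J z)%:E)%E by move=> Qz; rewrite lee_fin J0//; exact: QA.
rewrite nuJE//.
split.
  rewrite -integral_cst//; apply: ge0_le_integral => // z Qz.
  by have := Qe z Qz; rewrite lee_fin ltr_norml => /andP[]; lra.
rewrite -!integral_cst// -ge0_integralD//; last by move=> z _; rewrite lee_fin ltW.
apply: ge0_le_integral => //.
- by move=> z _; rewrite lee_fin J0.
- exact: emeasurable_funD.
move=> z Qz /=.
by have := Qe z Qz; rewrite lee_fin ltr_norml => /andP[]; lra.
Unshelve. all: by end_near. Qed.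

(** The closed box is a compact subset of [A], on which [J] has a maximum. *)
Lemma nuJ_fin a b c d : a < b -> c < d -> ccbox a b c d `<=` A -> (nuJ (ocbox a b c d) < +oo)%E.
Proof.
move=> ab cd QA.
have sub : ocbox a b c d `<=` ccbox a b c d.
  move=> z [] /=; rewrite !in_itv/= => /andP[/ltW z1 z2] /andP[/ltW z3 z4].
  by split; rewrite /= in_itv/= ?z1 ?z3.
have : exists2 z, z \in ccbox a b c d & forall t, t \in ccbox a b c d -> J t <= J z.
  apply: compact_EVT_max.
  - by exists (a, c); split; rewrite /= in_itv/= lexx ltW.
  - by apply: compact_setX; exact: segment_compact.
  - apply: continuous_in_subspaceT => z /set_mem /QA Az; exact: cJ.
move=> [z _ zmax].
have subA : ocbox a b c d `<=` A by exact: subset_trans QA.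
rewrite nuJE//.
apply: (@le_lt_trans _ _ ((J z)%:E * mu2 (ocbox a b c d))%E); last first.
  by rewrite mu2_ocbox ?ltW// -EFinM ltry.
have mQ := measurable_ocbox a b c d.
rewrite -integral_cst//.
apply: ge0_le_integral => //.
- by move=> t /subA At; rewrite lee_fin J0.
- exact: mJQ.
- by move=> t /sub Qt; rewrite lee_fin zmax// mem_set.
Qed.

End continuous_density.

(** * Area of the image of a Borel set *)

Section change_of_variables_sets.
Context {R : realType}.
Notation RR := (measurableTypeR R).
Notation mu2 := (@lebesgue_measure R \x @lebesgue_measure R)%E.

Variables (A V : set (R * R)) (T S : R * R -> R * R) (J : R * R -> R).
Hypotheses (oA : open A) (oV : open V).
Hypothesis TA : forall x, A x -> V (T x) /\ S (T x) = x.
Hypothesis SV : forall y, V y -> A (S y) /\ T (S y) = y.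
Hypothesis dT : forall x, A x -> differentiable T x.
Hypothesis dS : forall y, V y -> differentiable S y.
Hypothesis cJ : forall x, A x -> {for x, continuous J}.
Hypothesis JE : forall x, A x -> J x = `|det2 ('d T x)|.

Let J0 x : A x -> 0 <= J x.
Proof. by move=> /JE ->. Qed.

Lemma jac_inverse x : A x ->
  (forall v, 'd S (T x) ('d T x v) = v) /\ (forall v, 'd T x ('d S (T x) v) = v).
Proof.
move=> Ax; have [VTx STx] := TA _ Ax; split.
  apply: diff_cancel; [exact: dT|exact: dS|].
  by apply: filterS (open_nbhs_nbhs (conj oA Ax)) => y Ay; case: (TA _ Ay).
(* The chain rule yields the differential of [T] at S (T x); the variable [x'] allows this base
   point to be replaced by [x]. *)
have H x' : S (T x) = x' -> A x' -> forall v, 'd T x' ('d S (T x) v) = v.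
  move=> <- AS; apply: diff_cancel; [exact: dS|exact: dT|].
  by apply: filterS (open_nbhs_nbhs (conj oV VTx)) => y Vy; case: (SV _ Vy).
exact: H.
Qed.

(** Here [X] is the area of a box, [u] that of its image and [r] the integral of the Jacobian: [u]
    and [r] are both within (k / 2) X of j X. *)
Let box_arith (j k k1 X r u : R) : j * k1 <= k / 2 -> 0 < X ->
  j * (1 - k1) * X <= u -> u <= j * (1 + k1) * X ->
  r <= (j + k / 2) * X -> j * X <= r + k / 2 * X ->
  r <= u + k * X /\ u <= r + k * X.
Proof. by move=> jk X0 h1 h2 h3 h4; split; nra. Qed.

Let mSX (X : set (RR * RR)) : measurable X -> measurable (V `&` S @^-1` X : set (RR * RR)).
Proof.
apply: measurable_preimage_continuous => // y Vy.
exact/differentiable_continuous/dS.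
Qed.

Let box_ball (x : R * R) (a c w h t e : R) : 0 < w -> 0 < h -> 0 < t ->
  t < e / Num.max w h ->
  ccbox a (a + w * t) c (c + h * t) x -> ocbox a (a + w * t) c (c + h * t) `<=` ball x e.
Proof.
move=> w0 h0 t0; have m0 : 0 < Num.max w h by rewrite lt_max w0.
rewrite ltr_pdivlMr// => te.
have w1 : w * t <= t * Num.max w h by rewrite mulrC ler_pM2l// le_max lexx.
have h1 : h * t <= t * Num.max w h by rewrite mulrC ler_pM2l// le_max lexx orbT.
move=> [] /=; rewrite !in_itv/= => /andP[x1 x2] /andP[x3 x4] z [] /=.
rewrite !in_itv/= => /andP[z1 z2] /andP[z3 z4].
by split; rewrite /ball/= ltr_norml; apply/andP; split; lra.
Qed.

(** The set on the left is the image of [X] by [T]. Written as a preimage by [S], its area is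
    visibly a measure in [X], a pushforward, to be compared on boxes with the measure of density
    [J]. *)
Lemma lebesgue2_preimage (X : set (RR * RR)) : measurable X -> X `<=` A ->
  mu2 (V `&` S @^-1` X) = (\int[mu2]_(x in X) (J x)%:E)%E.
Proof.
have mV : measurable (V : set (RR * RR)) by exact: open_measurable2.
pose S0 : RR * RR -> RR * RR := fun y => ((fst \o S) \_ V y, (snd \o S) \_ V y).
have S0E y : V y -> S0 y = S y by move=> Vy; rewrite /S0 !patchE mem_set//=; case: (S y).
have VS0 X' : S0 @^-1` X' `&` V = V `&` S @^-1` X'.
  by apply/seteqP; split=> y /= []; [move=> + Vy|move=> Vy]; rewrite S0E.
have mS0 : measurable_fun setT S0.
  apply: measurable_continuous_restrict => // y Vy.
  exact/differentiable_continuous/dS.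
pose m2 : {measure set (RR * RR) -> \bar R} :=
  measure_function_pushforward__canonical__measure_function_Measure
   (measure_function_mrestr__canonical__measure_function_Measure mu2 mV) mS0.
have m2E X' : m2 X' = mu2 (V `&` S @^-1` X').
  by rewrite /m2/= /pushforward /mrestr/= VS0.
have [m1 m1E] := density_measure _ _ _ mu2 _ (measurable_restrJ A J oA cJ) (restrJ_ge0 A J J0).
move=> mX XA; rewrite -m2E -(nuJE A)// /nuJ -m1E.
apply/esym; move: X mX XA.
have loc (x : R * R) (w h k : R) : A x -> 0 < w -> 0 < h -> 0 < k -> exists2 e, 0 < e &
    forall t a c, 0 < t < e -> ccbox a (a + w * t) c (c + h * t) x ->
      ocbox a (a + w * t) c (c + h * t) `<=` A ->
      (m1 (ocbox a (a + w * t) c (c + h * t)) <=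
       m2 (ocbox a (a + w * t) c (c + h * t)) + (k * (w * t * (h * t)))%:E /\
      m2 (ocbox a (a + w * t) c (c + h * t)) <=
       m1 (ocbox a (a + w * t) c (c + h * t)) + (k * (w * t * (h * t)))%:E)%E.
  move=> Ax w0 h0 k0.
  have [VTx STx] := TA _ Ax.
  have [ML LM] := jac_inverse _ Ax.
  pose j := J x.
  have j0 : 0 <= j by exact: J0.
  have k20 : 0 < k / 2 by rewrite divr_gt0.
  (* The relative error of the image area becomes the absolute error j k1 <= k / 2 per unit area;
     [j + 1] is a positive denominator even where j = 0. *)
  pose k1 := k / 2 / (j + 1).
  have j1 : 0 < j + 1 by rewrite ltr_wpDl.
  have k10 : 0 < k1 by rewrite divr_gt0.
  have jk1 : j * k1 <= k / 2.
    rewrite /k1 mulrA ler_pdivrMr// mulrC ler_pM2l//; lra.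
  have dSe (e : R) : 0 < e ->
      \forall y \near T x, `|S y - x - 'd S (T x) (y - T x)| <= e * `|y - T x|.
    move=> e0; apply: filterS (differentiable_eps _ _ _ _ _ e (dS _ VTx) e0) => y.
    by rewrite STx.
  have mSb a b c d : measurable (V `&` S @^-1` ocbox a b c d : set (RR * RR)).
    by apply: mSX; exact: measurable_ocbox.
  have [r1 r10 H1] := local_estimate A V T S TA SV oV mSb x ('d T x) ('d S (T x)) _ _ _
    Ax w0 h0 k10 LM ML (fun e => differentiable_eps _ _ _ _ _ e (dT _ Ax)) dSe.
  have [r2 /= r20 H2] := nuJ_bound A J oA cJ J0 x _ Ax k20.
  have m0 : 0 < Num.max w h by rewrite lt_max w0.
  (* The second term puts the box in the ball of radius r2 / 2 about [x], where the integral of [J]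
     is controlled. *)
  exists (Num.min r1 (r2 / 2 / Num.max w h)).
    by rewrite lt_min r10 !divr_gt0.
  move=> t a c /andP[t0]; rewrite lt_min => /andP[tr1 tr2] xQ QA.
  have wt0 : 0 < w * t by rewrite mulr_gt0.
  have ht0 : 0 < h * t by rewrite mulr_gt0.
  have t01 : 0 < t < r1 by rewrite t0.
  have /andP[l1 l2] := H1 _ _ _ t01 xQ QA.
  rewrite -JE// -/j in l1 l2.
  have Qball := box_ball _ _ _ _ _ _ _ w0 h0 t0 tr2 xQ.
  have r2h : 0 < r2 / 2 by rewrite divr_gt0.
  have r22 : ball 0 r2 (r2 / 2).
    by rewrite /ball/= sub0r normrN gtr0_norm// ltr_pdivrMr// ltr_pMr// ltr1n.
  have [l3 l4] := H2 (r2 / 2) r22 r2h _ (measurable_ocbox _ _ _ _) Qball QA.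
  have muQ : mu2 (ocbox a (a + w * t) c (c + h * t)) = (w * t * (h * t))%:E.
    rewrite mu2_ocbox; [congr EFin; ring|by rewrite lerDl ltW|by rewrite lerDl ltW].
  rewrite m2E !m1E -/(nuJ A J _).
  rewrite muQ -!EFinM in l3 l4; move: l1 l2 l3 l4.
  set Q := ocbox _ _ _ _.
  have [] : (0 <= nuJ A J Q /\ 0 <= mu2 (V `&` S @^-1` Q))%E by split => //; apply: integral_ge0 => ? _; exact: restrJ_ge0.
  case: (nuJ A J Q) => [r| |]; [|by move=> _ _ _ _; rewrite leye_eq|by case].
  case: (mu2 (V `&` S @^-1` Q)) => [u| |]; [|by move=> _ _ _; rewrite leye_eq|by move=> _ []].
  move=> r0 u0; rewrite -!EFinD !lee_fin -/j.
  have := mulr_gt0 wt0 ht0.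
  exact: box_arith.
apply: eq_measure_ocboxes => // a b c d ab cd QA; split.
  apply/eqP; rewrite eq_le; apply/andP; split; apply: (measure_le_ocbox _ _ A) => // x w h k Ax w0 h0 k0;
    have [e e0 He] := loc x w h k Ax w0 h0 k0; exists e => // t a' c' te xQ Q'A;
    by have [] := He _ _ _ te xQ Q'A.
by rewrite m1E; exact: (nuJ_fin A J).
Qed.

End change_of_variables_sets.

(** * From measures of sets to integrals *)

Section transfer.
Local Open Scope ereal_scope.
Context d1 d2 (T1 : measurableType d1) (T2 : measurableType d2) (R : realType).
Variables (m1 : {measure set T1 -> \bar R}) (m2 : {measure set T2 -> \bar R}).
Variables (D : set T1) (E : set T2) (phi : T1 -> T2) (w : T1 -> \bar R).
Hypotheses (mD : measurable D) (mE : measurable E).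
Hypothesis mphi : measurable_fun D phi.
Hypothesis phiDE : forall x, D x -> E (phi x).
Hypothesis mw : measurable_fun D w.
Hypothesis w0 : forall x, D x -> 0 <= w x.
Hypothesis wfin : forall x, D x -> w x \is a fin_num.
Hypothesis m2E : forall X, measurable X -> X `<=` E ->
  m2 X = \int[m1]_(x in D `&` phi @^-1` X) w x.

Import HBNNSimple.

Let transfer_nnsfun (h : {nnsfun T2 >-> R}) :
  \int[m2]_(y in E) (h y)%:E = \int[m1]_(x in D) ((h (phi x))%:E * w x).
Proof.
under eq_integral do rewrite fimfunE -fsumEFin//.
rewrite ge0_integral_fsum//; last 2 first.
  by move=> r; apply/measurable_EFinP/measurable_funM => //; apply: measurable_funTS.
  by move=> r y _; rewrite EFinM nnfun_muleindic_ge0.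
have mhr r : measurable (h @^-1` [set r]) by rewrite -[X in measurable X]setTI; exact: measurable_funP.
have mphir r : measurable (D `&` phi @^-1` (h @^-1` [set r])) by exact: mphi.
transitivity (\sum_(r \in range h) \int[m1]_(x in D)
    ((r * \1_(h @^-1` [set r]) (phi x))%:E * w x)).
  apply: eq_fsbigr => r _.
  (* A negative [r] is not a value of [h], so both integrands vanish. *)
  have [r0|r0] := leP 0%R r; last first.
    rewrite !integral0_eq// => x _; rewrite preimage_nnfun0//= indicE in_set0 mulr0//.
    by rewrite mul0e.
  under eq_integral do rewrite EFinM.
  rewrite ge0_integralZl//; last by apply/measurable_EFinP; apply: measurable_funTS.
  under [RHS]eq_integral do rewrite EFinM -muleA.
  rewrite ge0_integralZl//; last 2 first.
    apply: emeasurable_funM => //; apply/measurable_EFinP.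
    apply: measurableT_comp => //.
    by move=> x Dx; rewrite mule_ge0// ?lee_fin// w0.
  congr (_ * _); rewrite integral_indic// m2E; last 2 first.
  - exact: measurableI.
  - by move=> ? [].
  rewrite [RHS]integral_mkcond [LHS]integral_mkcond; apply: eq_integral => x _.
  rewrite !patchE; case: ifPn => xD; case: ifPn => Dx //.
  - have [_ [hx _]] := set_mem xD; by rewrite indicE mem_set// mul1e.
  - have [Dx' _] := set_mem xD; by move: Dx; rewrite mem_set.
  - rewrite indicE memNset ?mul0e// => hx; move/negP: xD; apply; apply: mem_set.
    by split; [exact: set_mem|split=> //; exact/phiDE/set_mem].
rewrite -ge0_integral_fsum//.
- apply: eq_integral => x /set_mem Dx; rewrite [in RHS](fimfunE h) -fsumEFin//.
  rewrite -ge0_mule_fsuml//.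
  by move=> r; rewrite EFinM nnfun_muleindic_ge0.
- move=> r; apply: emeasurable_funM => //; apply/measurable_EFinP.
  by apply: measurable_funM => //; apply: measurableT_comp.
- by move=> r x Dx; rewrite mule_ge0 ?w0// EFinM nnfun_muleindic_ge0.
Qed.

(** Simple functions approximate [f] from below and both sides pass to the monotone limit;
    finiteness of the weight makes multiplication by it commute with that limit. *)
Lemma integral_transfer (f : T2 -> \bar R) :
  measurable_fun E f -> (forall y, E y -> 0 <= f y) ->
  \int[m2]_(y in E) f y = \int[m1]_(x in D) (f (phi x) * w x).
Proof.
move=> mf f0; pose h := nnsfun_approx mE mf.
have fE y : E y -> (h n y)%:E @[n --> \oo] --> f y by move=> Ey; exact: cvg_nnsfun_approx.
transitivity (limn (fun n => \int[m2]_(y in E) (h n y)%:E)).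
  rewrite -monotone_convergence//.
  - by apply: eq_integral => y /set_mem Ey; apply/esym/cvg_lim => //; exact: fE.
  - by move=> n; exact/measurable_EFinP/measurable_funTS.
  - by move=> n y _; rewrite lee_fin.
  - by move=> y _ a b ab; rewrite lee_fin; exact/lefP/nd_nnsfun_approx.
transitivity (limn (fun n => \int[m1]_(x in D) ((h n (phi x))%:E * w x))).
  by apply: congr_lim; apply/funext => n; exact: transfer_nnsfun.
rewrite -monotone_convergence//.
- apply: eq_integral => x /set_mem Dx; apply/cvg_lim => //.
  by apply: cvgeZr; [exact: wfin|exact/fE/phiDE].
- move=> n; apply: emeasurable_funM => //; apply/measurable_EFinP.
  exact: measurableT_comp.
- by move=> n x Dx; rewrite mule_ge0 ?lee_fin ?w0.
- move=> x Dx a b ab; rewrite lee_wpmul2r ?w0// lee_fin.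
  exact/lefP/nd_nnsfun_approx.
Qed.

End transfer.

Section change_of_variables.
Context {R : realType}.
Notation RR := (measurableTypeR R).
Notation mu2 := (@lebesgue_measure R \x @lebesgue_measure R)%E.

Lemma measurable_fun_continuous2 (W : set (R * R)) (f : R * R -> R * R) :
  open W -> (forall x, W x -> {for x, continuous f}) ->
  measurable_fun (W : set (RR * RR)) (f : RR * RR -> RR * RR).
Proof. by move=> oW cf _ X mX; exact: measurable_preimage_continuous. Qed.

Lemma change_of_variables2 (A V : set (R * R)) (T S : R * R -> R * R)
    (J : R * R -> R) (f : RR * RR -> \bar R) :
  open A -> open V ->
  (forall x, A x -> V (T x) /\ S (T x) = x) ->
  (forall y, V y -> A (S y) /\ T (S y) = y) ->
  (forall x, A x -> differentiable T x) ->
  (forall y, V y -> differentiable S y) ->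
  (forall x, A x -> {for x, continuous J}) ->
  (forall x, A x -> J x = `|det2 ('d T x)|) ->
  measurable_fun (V : set (RR * RR)) f -> (forall y, V y -> (0 <= f y)%E) ->
  (\int[mu2]_(y in V) f y = \int[mu2]_(x in A) (f (T x) * (J x)%:E))%E.
Proof.
move=> oA oV TA SV dT dS cJ JE mf f0.
have mT : measurable_fun (A : set (RR * RR)) (T : RR * RR -> RR * RR).
  apply: measurable_fun_continuous2 => // x Ax.
  exact/differentiable_continuous/dT.
have mA := open_measurable2 _ oA.
apply: integral_transfer => //.
- exact: open_measurable2.
- by move=> x /TA[].
- by apply/measurable_EFinP; exact: continuous_measurable2.
- by move=> x Ax; rewrite lee_fin JE.
(* The formula for sets is applied to the part of [A] that [T] sends into [X]; its image is all of
   [X] because [X] lies in [V]. *)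
- move=> X mX XV; rewrite -(lebesgue2_preimage A V T S J oA oV TA SV dT dS cJ JE); [|exact: mT|by move=> ? []].
  congr (mu2 _); apply/seteqP; split => y.
    by move=> Xy; have Vy := XV y Xy; have [AS TS] := SV y Vy; rewrite /= TS.
  by move=> [Vy [_ /=]]; have [_ ->] := SV y Vy.
Qed.

End change_of_variables.

(** * The complex plane as a real plane *)

Section complex_plane.
Context {R : realType}.
Implicit Types (z w : R[i]).

Lemma toCK z : toC (toR2 z) = z. Proof. by case: z. Qed.
Lemma toR2K (x : R * R) : toR2 (toC x) = x. Proof. by case: x. Qed.

Lemma toR2B z w : toR2 (z - w) = toR2 z - toR2 w.
Proof. by case: z w => ? ? []. Qed.

Lemma toCB (x y : R * R) : toC (x - y) = toC x - toC y. Proof. by []. Qed.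

Lemma normc_sqr z : normc z ^+ 2 = complex.Re z ^+ 2 + complex.Im z ^+ 2.
Proof. by case: z => a b /=; rewrite sqr_sqrtr// addr_ge0// sqr_ge0. Qed.

Lemma normc_nonneg z : 0 <= normc z. Proof. by case: z => a b /=; rewrite sqrtr_ge0. Qed.

Lemma toR2_le_normc z : `|toR2 z| <= normc z.
Proof.
rewrite prod_normE/= ge_max -!(ler_sqr _ (normc_nonneg z)) ?nnegrE// !real_normK ?num_real//.
by rewrite normc_sqr lerDl lerDr !sqr_ge0.
Qed.

(** The norm of the product is the maximum norm; the optimal constant would be sqrt 2, and any
    constant serves to compare neighbourhoods. *)
Lemma normc_le_toR2 z : normc z <= 2 * `|toR2 z|.
Proof.
rewrite -(ler_sqr (normc_nonneg z)) ?nnegrE ?mulr_ge0// normc_sqr.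
have h1 : `|complex.Re z| <= `|toR2 z| by rewrite prod_normE/= le_max lexx.
have h2 : `|complex.Im z| <= `|toR2 z| by rewrite prod_normE/= le_max lexx orbT.
have := normr_ge0 (toR2 z); move: h1 h2; rewrite !ler_norml => /andP[? ?] /andP[? ?] ?; nra.
Qed.

Lemma nbhs_complexP z (P : set R[i]^o) : nbhs (z : R[i]^o) P ->
  exists2 d : R, 0 < d & forall w, normc (w - z) < d -> P w.
Proof.
(* Radii are themselves complex numbers here, and positivity forces the imaginary part [d'] to be
   zero. *)
move=> /nbhs_ballP[[d d'] /=]; rewrite ltcE/= => /andP[/eqP -> d0] dP.
exists d => // w wz; apply: dP; rewrite -ball_normE/= distrC.
by rewrite normc_def ltcE/= eqxx/=; case: (w - z) wz.
Qed.

Lemma nbhs_toC (x : R * R) (P : set R[i]^o) : nbhs (toC x : R[i]^o) P ->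
  \forall y \near x, P (toC y).
Proof.
move=> /nbhs_complexP[d d0 dP]; apply/nbhs_ballP; exists (d / 2) => /=; first by rewrite divr_gt0.
move=> y; rewrite -ball_normE/= distrC => xy; apply: dP.
rewrite (le_lt_trans (normc_le_toR2 _))// mulrC -ltr_pdivlMr//.

Qed.

Lemma open_toC (U : set R[i]) : open_in_C U -> open (@toC R @^-1` U).
Proof.
move=> oU; rewrite openE => x Ux; apply: nbhs_toC; exact: open_nbhs_nbhs.
Qed.

Lemma differentiable_of_eps (V W : normedModType R) (f : V -> W) (x : V) (df : {linear V -> W}) :
  continuous df ->
  (forall e, 0 < e -> \forall y \near x, `|f y - f x - df (y - x)| <= e * `|y - x|) ->
  differentiable f x /\ ('d f x = df :> (V -> W)).
Proof.
move=> cdf He.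
have E : f \o shift x = cst (f x) + df +o_ 0 id.
  apply/eqaddoP => e e0.
  have /nbhs_ballP[d /= d0 Hd] := He e e0.
  apply/nbhs_ballP; exists d => //= y; rewrite -ball_normE/= sub0r normrN => yd.
  have := Hd (y + x); rewrite -ball_normE/= opprD addrC subrK normrN => /(_ yd).
  by rewrite !fctE /= addrK opprD addrA.
have dE := diff_unique cdf E; split => //.
by apply/diff_locallyP; rewrite dE.
Qed.

(** Multiplication by [c] as a real-linear map: the form that the Cauchy-Riemann equations give to
    the differential of a holomorphic function. *)
Definition cmul2 (c : R[i]) (h : R * R) : R * R := toR2 (c * toC h).

Lemma cmul2_linear c : linear (cmul2 c).
Proof.
case: c => a b k x y; apply: injective_projections; rewrite /cmul2/= /GRing.scale/=; ring.
Qed.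
HB.instance Definition _ c := GRing.isLinear.Build R (R * R)%type (R * R)%type _ (cmul2 c) (cmul2_linear c).

Lemma continuous_cmul2 c : continuous (cmul2 c).
Proof.
case: c => a b x.
have h1 : (a * y.1 - b * y.2) @[y --> x] --> a * x.1 - b * x.2.
  by apply: cvgB; (apply: cvgM; [exact: cvg_cst|]); [exact: cvg_fst|exact: cvg_snd].
have h2 : (a * y.2 + b * y.1) @[y --> x] --> a * x.2 + b * x.1.
  by apply: cvgD; (apply: cvgM; [exact: cvg_cst|]); [exact: cvg_snd|exact: cvg_fst].
exact: (cvg_pair h1 h2).
Qed.

Lemma holomorphic_diff (q : R[i] -> R[i]) (z : R[i]) :
  derivable (q : R[i]^o -> R[i]^o) z 1 ->
  exists c : R[i], differentiable (@toR2 R \o q \o @toC R) (toR2 z) /\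
    ('d (@toR2 R \o q \o @toC R) (toR2 z) = cmul2 c :> (R * R -> R * R)).
Proof.
move=> /derivable1_diffP dq; exists ('d (q : R[i]^o -> R[i]^o) (z : R[i]^o) 1).
set c := 'd _ _ _.
apply: differentiable_of_eps; first exact: continuous_cmul2.
(* Halving [e] absorbs the factor 2 between the modulus and the maximum norm. *)
move=> e e0; have e0' : 0 < (e / 2)%:C by rewrite ltcR divr_gt0.
have := differentiable_eps _ _ _ _ _ _ dq e0'.
rewrite -{1}(toCK z) => /nbhs_toC; apply: filterS => y.
have -> : 'd (q : R[i]^o -> R[i]^o) (z : R[i]^o) (toC y - z) = c * (toC y - z).
  rewrite -[X in 'd _ _ X]mulr1 -[_ * 1]/((toC y - z) *: (1 : R[i]^o)) linearZ/=.
  by rewrite mulrC.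
have normE (w : R[i]) : `|w| = (normc w)%:C by rewrite normc_def; case: w.
rewrite !normE -rmorphM lecR => h.
have E : toR2 (q (toC y)) - toR2 (q (toC (toR2 z))) - cmul2 c (y - toR2 z) =
   toR2 (q (toC y) - q z - c * (toC y - z)).
  by rewrite toCK !toR2B /cmul2 toCB toCK.
rewrite /= E (le_trans (toR2_le_normc _))// (le_trans h)//.
rewrite -mulrA (ler_wpM2l (ltW e0))// ler_pdivrMl// (le_trans (normc_le_toR2 _))//.
by rewrite toR2B toR2K.
Qed.

End complex_plane.

(** * The Jacobian along a horizontal foliation *)

(* Here q = u + i v has complex derivative a + i b, g = g1 + i g2 has s-derivative
   c1 + i c2 and p-derivative h1 + i h2, the latter being also the s-derivative of
   k = k1 + i k2.  [im2] and [re2] are the imaginary and real parts of a derivative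
   of lam = q g^2.  The cofactors come from multiplying
   lam_s k g + 2 lam (g_p g - k g_s) = lam_p g^2 by the square of the conjugate of g. *)
Lemma conformal_identity (R : comNzRingType) (a b u v g1 g2 k1 k2 c1 c2 h1 h2 : R) :
  let im2 x y us vs x' y' := us * (x * y + x * y) + u * (x' * y + x * y' + (x' * y + x * y'))
     + (vs * (x * x - y * y) + v * (x' * x + x * x' - (y' * y + y * y'))) in
  let re2 x y us vs x' y' := us * (x * x - y * y) + u * (x' * x + x * x' - (y' * y + y * y'))
     - (vs * (x * y + x * y) + v * (x' * y + x * y' + (x' * y + x * y'))) in
  let us := a * g1 - b * g2 in let vs := b * g1 + a * g2 in
  let up := a * k1 - b * k2 in let vp := b * k1 + a * k2 in
  let lam := u * (g1 * g1 - g2 * g2) - v * (g1 * g2 + g1 * g2) in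
  let G := g1 * g1 + g2 * g2 in
  let jac := g1 * k2 - g2 * k1 in
  let jacs := c1 * k2 + g1 * h2 - (c2 * k1 + g2 * h1) in
  u * (g1 * g2 + g1 * g2) + v * (g1 * g1 - g2 * g2) = 0 ->
  im2 g1 g2 us vs c1 c2 = 0 -> im2 g1 g2 up vp h1 h2 = 0 ->
  re2 g1 g2 us vs c1 c2 * jac * G + 2 * lam * jacs * G
    - 4 * lam * jac * (g1 * c1 + g2 * c2) = 0.
Proof.
move=> im2 re2 us vs up vp lam G jac jacs N0 Ns Np.
set F := LHS.
have -> : F = G ^+ 2 * im2 g1 g2 up vp h1 h2
   - im2 g1 g2 us vs c1 c2 *
     ((g1 * g1 - g2 * g2) * (k1 * g1 - k2 * g2) + 2 * g1 * g2 * (k1 * g2 + k2 * g1))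
   - 2 * (u * (g1 * g2 + g1 * g2) + v * (g1 * g1 - g2 * g2)) *
     ((g1 * g1 - g2 * g2) * (h1 * g1 - h2 * g2 - (k1 * c1 - k2 * c2))
      + 2 * g1 * g2 * (h1 * g2 + h2 * g1 - (k1 * c2 + k2 * c1))).
  rewrite /F /im2 /re2 /us /vs /up /vp /lam /G /jac /jacs; ring.
by rewrite N0 Ns Np !mulr0 !mul0r !subr0.
Qed.

(** * Partial derivatives and their symmetry *)

Section partial.
Context {R : realType}.
Implicit Types (f : R * R -> R) (T : R * R -> R * R).

Lemma partial1E (W : normedModType R) (f : R * R -> W) (s p : R) :
  (derivable (fun t => f (t, p)) s 1 <-> derivable f (s, p) e1) /\
  'D_1 (fun t => f (t, p)) s = 'D_e1 f (s, p).
Proof.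
rewrite /derivable /derive.
have -> // : (fun h => h^-1 *: (((fun t => f (t, p)) \o shift s) (h *: 1) - f (s, p))) =
   (fun h => h^-1 *: ((f \o shift (s, p)) (h *: e1) - f (s, p))).
apply/funext => h; congr (_ *: (f _ - _)).
by apply: injective_projections; rewrite /= /GRing.scale/= ?mulr0 ?add0r.
Qed.

Lemma partial2E (W : normedModType R) (f : R * R -> W) (s p : R) :
  (derivable (fun t => f (s, t)) p 1 <-> derivable f (s, p) e2) /\
  'D_1 (fun t => f (s, t)) p = 'D_e2 f (s, p).
Proof.
rewrite /derivable /derive.
have -> // : (fun h => h^-1 *: (((fun t => f (s, t)) \o shift p) (h *: 1) - f (s, p))) =
   (fun h => h^-1 *: ((f \o shift (s, p)) (h *: e2) - f (s, p))).
apply/funext => h; congr (_ *: (f _ - _)).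
by apply: injective_projections; rewrite /= /GRing.scale/= ?mulr0 ?add0r.
Qed.

Lemma is_derive_partial1 f s p df : is_derive (s, p) e1 f df ->
  is_derive s 1 (fun t => f (t, p)) df.
Proof.
move=> [d <-]; have [dE E] := partial1E _ f s p.
by apply: DeriveDef; [exact: (dE.2 d)|exact: E].
Qed.

Lemma is_derive_partial2 f s p df : is_derive (s, p) e2 f df ->
  is_derive p 1 (fun t => f (s, t)) df.
Proof.
move=> [d <-]; have [dE E] := partial2E _ f s p.
by apply: DeriveDef; [exact: (dE.2 d)|exact: E].
Qed.

Lemma is_derive_fst (V : normedModType R) (T : V -> R * R) x v : derivable T x v ->
  is_derive x v (fun y => (T y).1) ('D_v T x).1.
Proof.
move=> dT; have h : (h^-1 *: ((T \o shift x) (h *: v) - T x)).1 @[h --> 0^'] --> ('D_v T x).1.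
  have h0 : (fun h => h^-1 *: ((T \o shift x) (h *: v) - T x)) @ 0^' --> 'D_v T x by exact: dT.
  apply: (cvg_comp _ _ h0); exact: cvg_fst.
by apply: DeriveDef; [apply/cvg_ex; eexists; exact: h|apply/cvg_lim].
Qed.

Lemma is_derive_snd (V : normedModType R) (T : V -> R * R) x v : derivable T x v ->
  is_derive x v (fun y => (T y).2) ('D_v T x).2.
Proof.
move=> dT; have h : (h^-1 *: ((T \o shift x) (h *: v) - T x)).2 @[h --> 0^'] --> ('D_v T x).2.
  have h0 : (fun h => h^-1 *: ((T \o shift x) (h *: v) - T x)) @ 0^' --> 'D_v T x by exact: dT.
  apply: (cvg_comp _ _ h0); exact: cvg_snd.
by apply: DeriveDef; [apply/cvg_ex; eexists; exact: h|apply/cvg_lim].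
Qed.

Lemma MVT_is_derive (f df : R -> R) (a b : R) : a <= b ->
  (forall x, a <= x <= b -> is_derive x 1 f (df x)) ->
  exists2 c, a <= c <= b & f b - f a = df c * (b - a).
Proof.
move=> ab dfab; have [c cab E] : exists2 c, c \in `[a, b]%R & f b - f a = df c * (b - a).
  apply: MVT_segment => //.
    by move=> x; rewrite in_itv/= => /andP[ax xb]; apply: dfab; rewrite !ltW.
  apply: derivable_within_continuous => x; rewrite in_itv/= => xab.
  by have [] := dfab x xab.
by exists c => //; rewrite in_itv in cab.
Qed.

Lemma second_difference (f f1 f12 : R -> R -> R) (a b h : R) : 0 < h ->
  (forall s p, a <= s <= a + h -> b <= p <= b + h -> is_derive s 1 (f ^~ p) (f1 s p)) ->
  (forall s p, a <= s <= a + h -> b <= p <= b + h -> is_derive p 1 (f1 s) (f12 s p)) ->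
  exists s p, [/\ a <= s <= a + h, b <= p <= b + h &
    f (a + h) (b + h) - f (a + h) b - f a (b + h) + f a b = f12 s p * h ^+ 2].
Proof.
move=> h0 df1 df12.
have ah : a <= a + h by rewrite lerDl ltW.
have bh : b <= b + h by rewrite lerDl ltW.
have bb : b <= b <= b + h by rewrite lexx.
have bbh : b <= b + h <= b + h by rewrite lexx bh.
have [s sh E1] := @MVT_is_derive (fun s => f s (b + h) - f s b)
   (fun s => f1 s (b + h) - f1 s b) a (a + h) ah
   (fun x xh => is_deriveB (df1 x (b + h) xh bbh) (df1 x b xh bb)).
have [p ph E2] := @MVT_is_derive (f1 s) (f12 s) b (b + h) bh (fun y yh => df12 s y sh yh).
exists s, p; split=> //; move: E1; rewrite /= E2 !(addrC _ h) !addrK => E1.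
by rewrite expr2 mulrA -E1; ring.
Qed.

(** Over a small square at [x], the second difference of [f] divided by the area of the square is a
    value of [f12] and also a value of [f21]. Continuity puts each within e / 2 of its value at
    [x]. *)
Lemma schwarz f f1 f2 f12 f21 (W : set (R * R)) (x : R * R) : open W -> W x ->
  (forall y, W y -> is_derive y e1 f (f1 y) /\ is_derive y e2 f (f2 y)) ->
  (forall y, W y -> is_derive y e2 f1 (f12 y) /\ is_derive y e1 f2 (f21 y)) ->
  {for x, continuous f12} -> {for x, continuous f21} -> f12 x = f21 x.
Proof.
move=> oW Wx d1 d2 c1 c2; apply/eqP; rewrite -subr_eq0 -normr_le0.
apply/ler_addgt0Pl => e e0; rewrite addr0.
have e20 : 0 < e / 2 by rewrite divr_gt0.
have /cvgrPdist_le/(_ _ e20)/nbhs_ballP[r1 /= r10 H1] := c1.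
have /cvgrPdist_le/(_ _ e20)/nbhs_ballP[r2 /= r20 H2] := c2.
have /nbhs_ballP[r3 /= r30 H3] := open_nbhs_nbhs (conj oW Wx).
pose h := Num.min r1 (Num.min r2 r3) / 2.
have h0 : 0 < h by rewrite divr_gt0// !lt_min r10 r20.
have hr : h < Num.min r1 (Num.min r2 r3).
  by rewrite ltr_pdivrMr// ltr_pMr ?ltr1n// !lt_min r10 r20.
move: hr; rewrite !lt_min => /and3P[hr1 hr2 hr3].
have bl r s p : h < r -> x.1 <= s <= x.1 + h -> x.2 <= p <= x.2 + h -> ball x r (s, p).
  move=> hr /andP[s1 s2] /andP[p1 p2].
  by split; rewrite /ball/= ltr_norml; apply/andP; split; clear -hr s1 s2 p1 p2 h0; lra.
have Wb s p : x.1 <= s <= x.1 + h -> x.2 <= p <= x.2 + h -> W (s, p).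
  by move=> s1 p1; apply: H3; exact: bl.
have [s [p [sh ph E1]]] := @second_difference (fun s p => f (s, p))
  (fun s p => f1 (s, p)) (fun s p => f12 (s, p)) x.1 x.2 h h0
  (fun s p sh ph => is_derive_partial1 _ _ _ _ (d1 _ (Wb s p sh ph)).1)
  (fun s p sh ph => is_derive_partial2 _ _ _ _ (d2 _ (Wb s p sh ph)).1).
(* The second difference is symmetric in the two variables, so the transposed function has the same
   one. *)
have [p' [s' [ph' sh' E2]]] := @second_difference (fun p s => f (s, p))
  (fun p s => f2 (s, p)) (fun p s => f21 (s, p)) x.2 x.1 h h0
  (fun p s ph sh => is_derive_partial2 _ _ _ _ (d1 _ (Wb s p sh ph)).2)
  (fun p s ph sh => is_derive_partial1 _ _ _ _ (d2 _ (Wb s p sh ph)).2).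
have hn : h ^+ 2 != 0 by rewrite expf_neq0// gt_eqF.
have E : f12 (s, p) = f21 (s', p') by apply: (mulIf hn); rewrite -E1 -E2; ring.
rewrite (le_trans (ler_distD (f12 (s, p)) _ _))// [leRHS]splitr lerD//.
  exact: (H1 (s, p) (bl r1 s p hr1 sh ph)).
by rewrite distrC E; exact: (H2 (s', p') (bl r2 s' p' hr2 sh' ph')).
Qed.

Lemma partial1_eq0_cst f (s s' p : R) : s <= s' ->
  (forall t, s <= t <= s' -> is_derive (t, p) e1 f 0) -> f (s, p) = f (s', p).
Proof.
move=> ss' df.
have [c _] := @MVT_is_derive (fun t => f (t, p)) (cst 0) s s' ss'
  (fun t st => is_derive_partial1 f t p 0 (df t st)).
by rewrite mul0r => /eqP; rewrite subr_eq0 => /eqP.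
Qed.

End partial.

Section pointwise_derive.
Context {R : realType} {V : normedModType R}.

Lemma is_derive_mul {f g : V -> R} {x v : V} {df dg : R} : is_derive x v f df -> is_derive x v g dg ->
  is_derive x v (fun y => f y * g y) (df * g x + f x * dg).
Proof.
move=> hf hg; apply: (is_derive_eq (is_deriveM hf hg)).
by rewrite /GRing.scale/=; ring.
Qed.

Lemma is_derive_add {f g : V -> R} {x v : V} {df dg : R} : is_derive x v f df -> is_derive x v g dg ->
  is_derive x v (fun y => f y + g y) (df + dg).
Proof. by move=> hf hg; exact: is_deriveD. Qed.

Lemma is_derive_sub {f g : V -> R} {x v : V} {df dg : R} : is_derive x v f df -> is_derive x v g dg ->
  is_derive x v (fun y => f y - g y) (df - dg).
Proof. by move=> hf hg; exact: is_deriveB. Qed.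

Lemma is_derive_inv {f : V -> R} {x v : V} {df : R} : f x != 0 -> is_derive x v f df ->
  is_derive x v (fun y => (f y)^-1) (- df / f x ^+ 2).
Proof.
move=> fx0 [h1 h2]; apply: DeriveDef; first exact: derivableV.
by rewrite (deriveV fx0 h1) h2 /GRing.scale/= mulNr mulrC mulNr.
Qed.

(** The differentiated expression is lam * Im (k / g)^2. One complex number a + i b for both
    directions expresses that q is complex differentiable; one pair [h1], [h2] for g along [w2] and
    for k along [w1] expresses the symmetry of second derivatives. *)
Lemma conformal_derive {g1 g2 k1 k2 u v : V -> R} {x w1 w2 : V}
    {a b c1 c2 h1 h2 : R} :
  is_derive x w1 u (a * g1 x - b * g2 x) -> is_derive x w1 v (b * g1 x + a * g2 x) ->
  is_derive x w2 u (a * k1 x - b * k2 x) -> is_derive x w2 v (b * k1 x + a * k2 x) ->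
  is_derive x w1 g1 c1 -> is_derive x w1 g2 c2 ->
  is_derive x w2 g1 h1 -> is_derive x w2 g2 h2 ->
  is_derive x w1 k1 h1 -> is_derive x w1 k2 h2 ->
  (\forall y \near x, u y * (g1 y * g2 y + g1 y * g2 y) +
     v y * (g1 y * g1 y - g2 y * g2 y) = 0) ->
  g1 x * g1 x + g2 x * g2 x != 0 ->
  is_derive x w1 (fun y =>
    (u y * (g1 y * g1 y - g2 y * g2 y) - v y * (g1 y * g2 y + g1 y * g2 y)) *
    ((g1 y * k2 y - g2 y * k1 y) * (g1 y * k2 y - g2 y * k1 y)) *
    ((g1 y * g1 y + g2 y * g2 y) * (g1 y * g1 y + g2 y * g2 y))^-1) 0.
Proof.
move=> du1 dv1 du2 dv2 dg1 dg2 dg1' dg2' dk1 dk2 N0 G0.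
(* Im lam vanishes near [x], not just at [x], hence so do its derivatives in both directions. *)
have N0' w d : is_derive x w (fun y => u y * (g1 y * g2 y + g1 y * g2 y) +
     v y * (g1 y * g1 y - g2 y * g2 y)) d -> d = 0.
  by move=> [_ <-]; rewrite (near_eq_derive (g := cst 0) w N0); exact: derive_cst.
have dsq := is_derive_sub (is_derive_mul dg1 dg1) (is_derive_mul dg2 dg2).
have dpr := is_derive_add (is_derive_mul dg1 dg2) (is_derive_mul dg1 dg2).
have dsq' := is_derive_sub (is_derive_mul dg1' dg1') (is_derive_mul dg2' dg2').
have dpr' := is_derive_add (is_derive_mul dg1' dg2') (is_derive_mul dg1' dg2').
have Ns := N0' _ _ (is_derive_add (is_derive_mul du1 dpr) (is_derive_mul dv1 dsq)).
have Np := N0' _ _ (is_derive_add (is_derive_mul du2 dpr') (is_derive_mul dv2 dsq')).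
have F0 := conformal_identity R a b _ _ _ _ (k1 x) (k2 x) _ _ _ _ (nbhs_singleton N0) Ns Np.
have dlam := is_derive_sub (is_derive_mul du1 dsq) (is_derive_mul dv1 dpr).
have djac := is_derive_sub (is_derive_mul dg1 dk2) (is_derive_mul dg2 dk1).
have dG := is_derive_add (is_derive_mul dg1 dg1) (is_derive_mul dg2 dg2).
have dGi := is_derive_inv (mulf_neq0 G0 G0) (is_derive_mul dG dG).
apply: (is_derive_eq (is_derive_mul (is_derive_mul dlam (is_derive_mul djac djac)) dGi)).
(* The quotient rule leaves the expression of [conformal_identity] times jac / G^3. *)
rewrite -[RHS](mulr0 ((g1 x * k2 x - g2 x * k1 x) / (g1 x * g1 x + g2 x * g2 x) ^+ 3)) -F0.
by field.
Qed.

End pointwise_derive.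

(** * The invariant of the foliation *)

Section energy.
Context {R : realType}.
Variables (A : set (R * R)) (T Q : R * R -> R * R).
Hypothesis oA : open A.
Hypothesis dT : forall x v, A x -> derivable T x v.
Hypothesis ddT : forall x v w, A x -> derivable ('D_v T) x w.
Hypothesis cddT : forall x v w, A x -> {for x, continuous ('D_w ('D_v T))}.
Hypothesis dQ : forall x, A x -> exists c : R[i], forall w,
  derivable Q x w /\ 'D_w Q x = cmul2 c ('D_w T x).

(** With [sq_im], the real and imaginary parts of the complex product u g^2. *)
Definition sq_re (u g : R * R) : R :=
  u.1 * (g.1 * g.1 - g.2 * g.2) - u.2 * (g.1 * g.2 + g.1 * g.2).
Definition sq_im (u g : R * R) : R :=
  u.1 * (g.1 * g.2 + g.1 * g.2) + u.2 * (g.1 * g.1 - g.2 * g.2).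

Definition jac2 (g k : R * R) : R := g.1 * k.2 - g.2 * k.1.
Definition sqn (g : R * R) : R := g.1 * g.1 + g.2 * g.2.

Hypothesis hor : forall x, A x -> sq_im (Q x) ('D_e1 T x) = 0.
Hypothesis g0 : forall x, A x -> sqn ('D_e1 T x) != 0.

(* The square of sqrt lam * Im (k / g), which avoids differentiating square roots. *)
Definition energy x := sq_re (Q x) ('D_e1 T x) *
  (jac2 ('D_e1 T x) ('D_e2 T x) * jac2 ('D_e1 T x) ('D_e2 T x)) *
  (sqn ('D_e1 T x) * sqn ('D_e1 T x))^-1.

Lemma schwarz2 x : A x -> 'D_e2 ('D_e1 T) x = 'D_e1 ('D_e2 T) x.
Proof.
move=> Ax.
have d1 y v : A y -> is_derive y v (fun z => (T z).1) ('D_v T y).1.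
  by move=> Ay; exact: is_derive_fst _ _ _ _ (dT y v Ay).
have d2 y v : A y -> is_derive y v (fun z => (T z).2) ('D_v T y).2.
  by move=> Ay; exact: is_derive_snd _ _ _ _ (dT y v Ay).
have dd1 y v w : A y -> is_derive y w (fun z => ('D_v T z).1) ('D_w ('D_v T) y).1.
  by move=> Ay; exact: is_derive_fst _ _ _ _ (ddT y v w Ay).
have dd2 y v w : A y -> is_derive y w (fun z => ('D_v T z).2) ('D_w ('D_v T) y).2.
  by move=> Ay; exact: is_derive_snd _ _ _ _ (ddT y v w Ay).
have c1 v w : {for x, continuous (fun z => ('D_w ('D_v T) z).1)}.
  by apply: (cvg_comp _ _ (cddT x v w Ax)); exact: cvg_fst.
have c2 v w : {for x, continuous (fun z => ('D_w ('D_v T) z).2)}.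
  by apply: (cvg_comp _ _ (cddT x v w Ax)); exact: cvg_snd.
apply: injective_projections.
  exact: (schwarz _ _ _ _ _ _ _ oA Ax (fun y Ay => conj (d1 y e1 Ay) (d1 y e2 Ay))
    (fun y Ay => conj (dd1 y e1 e2 Ay) (dd1 y e2 e1 Ay)) (c1 e1 e2) (c1 e2 e1)).
exact: (schwarz _ _ _ _ _ _ _ oA Ax (fun y Ay => conj (d2 y e1 Ay) (d2 y e2 Ay))
    (fun y Ay => conj (dd2 y e1 e2 Ay) (dd2 y e2 e1 Ay)) (c2 e1 e2) (c2 e2 e1)).
Qed.

Lemma energy_derive x : A x -> is_derive x e1 energy 0.
Proof.
move=> Ax; have [[a b] Hc] := dQ x Ax.
have sw := schwarz2 x Ax.
have du w : is_derive x w (fun y => (Q y).1) (a * ('D_w T x).1 - b * ('D_w T x).2).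
  have [h E] := Hc w; apply: (is_derive_eq (is_derive_fst _ _ _ _ h)).
  exact: (congr1 fst E).
have dv w : is_derive x w (fun y => (Q y).2) (b * ('D_w T x).1 + a * ('D_w T x).2).
  have [h E] := Hc w; apply: (is_derive_eq (is_derive_snd _ _ _ _ h)).
  by rewrite addrC; exact: (congr1 snd E).
apply: (conformal_derive (du e1) (dv e1) (du e2) (dv e2)
  (is_derive_fst _ _ _ _ (ddT x e1 e1 Ax)) (is_derive_snd _ _ _ _ (ddT x e1 e1 Ax))
  (is_derive_fst _ _ _ _ (ddT x e1 e2 Ax)) (is_derive_snd _ _ _ _ (ddT x e1 e2 Ax))).
- apply: (is_derive_eq (is_derive_fst _ _ _ _ (ddT x e2 e1 Ax))).
  exact: (congr1 fst (esym sw)).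
- apply: (is_derive_eq (is_derive_snd _ _ _ _ (ddT x e2 e1 Ax))).
  exact: (congr1 snd (esym sw)).
- apply: filterS (open_nbhs_nbhs (conj oA Ax)) => y Ay; exact: hor.
- exact: g0.
Qed.

Lemma energy_cst (I J : set R) (s s' p : R) : A = I `*` J -> is_interval I ->
  I s -> I s' -> J p -> energy (s, p) = energy (s', p).
Proof.
move=> AE itvI; wlog ss' : s s' / s <= s'.
  move=> H Is Is' Jp; case: (leP s s') => [|/ltW] ss'; first exact: H.
  by apply/esym/H.
move=> Is Is' Jp.
have Ap t : s <= t <= s' -> A (t, p) by rewrite AE => st; split => //; exact: itvI st.
exact: (partial1_eq0_cst energy s s' p ss' (fun t st => energy_derive (t, p) (Ap t st))).
Qed.

(** Here [n] is |q|, [m] is |g|^2 and [j] is the Jacobian: the square root of the energy is sqrt n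
    |j| / sqrt m, which is solved for |j|. *)
Lemma sqrt_energyE (n m j lam : R) : 0 < n -> 0 < m -> lam = n * m ->
  `|j| = Num.sqrt (lam * (j * j) * (m * m)^-1) * (Num.sqrt m / Num.sqrt n).
Proof.
move=> n0 m0 ->.
have sn : Num.sqrt n != 0 by rewrite gt_eqF// sqrtr_gt0.
have sm : Num.sqrt m != 0 by rewrite gt_eqF// sqrtr_gt0.
have -> : n * m * (j * j) * (m * m)^-1 = (Num.sqrt n * `|j| / Num.sqrt m) ^+ 2.
  have jj : `|j| ^+ 2 = j * j by rewrite real_normK ?num_real// expr2.
  rewrite expr_div_n exprMn !sqr_sqrtr ?ltW// jj.
  by field; rewrite gt_eqF.
rewrite sqrtr_sqr [X in _ = X * _]ger0_norm ?divr_ge0 ?mulr_ge0 ?sqrtr_ge0//.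
by field; rewrite sn sm.
Qed.

(** [D p] is the square root of the energy, read at a base parameter [s0]. It measures how fast the
    curves move apart transversally, in the metric |q| |dz|^2, as p varies. *)
Lemma jac_factor (I J : set R) (n : R * R -> R) : A = I `*` J -> is_interval I -> I !=set0 ->
  (forall x, A x -> 0 < n x /\ sq_re (Q x) ('D_e1 T x) = n x * sqn ('D_e1 T x)) ->
  exists2 D : R -> R, forall p, 0 <= D p &
    forall s p, I s -> J p -> `|jac2 ('D_e1 T (s, p)) ('D_e2 T (s, p))| =
      D p * (Num.sqrt (sqn ('D_e1 T (s, p))) / Num.sqrt (n (s, p))).
Proof.
move=> AE itvI [s0 Is0] nE; exists (fun p => Num.sqrt (energy (s0, p))).
  by move=> p; exact: sqrtr_ge0.
move=> s p Is Jp; rewrite (energy_cst I J s0 s p AE itvI Is0 Is Jp).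
have Ax : A (s, p) by rewrite AE.
have [n0 lamE] := nE _ Ax.
apply: sqrt_energyE => //.
by rewrite lt_neqAle eq_sym (g0 _ Ax)/= /sqn -!expr2 addr_ge0// sqr_ge0.
Qed.

End energy.

(** * The extremal density *)

Section slices.
Context {R : realType}.
Notation RR := (measurableTypeR R).
Notation mu := (@lebesgue_measure R).
Notation mu2 := (@lebesgue_measure R \x @lebesgue_measure R)%E.
Local Open Scope ereal_scope.

Lemma integral_rectangle (I J : set R) (F : RR * RR -> \bar R) :
  measurable (I : set RR) -> measurable (J : set RR) ->
  measurable_fun (I `*` J : set (RR * RR)) F ->
  (forall x, (I `*` J) x -> 0 <= F x) ->
  [/\ \int[mu2]_(x in I `*` J) F x = \int[mu]_(p in J) \int[mu]_(s in I) F (s, p),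
      measurable_fun (J : set RR) (fun p => \int[mu]_(s in I) F (s, p)) &
      forall p, J p -> measurable_fun (I : set RR) (fun s => F (s, p))].
Proof.
move=> mI mJ mF F0; pose F' := F \_ (I `*` J).
have mIJ : measurable (I `*` J : set (RR * RR)) by exact: measurableX.
have mF' : measurable_fun setT F' by exact: (measurable_restrictT _ mIJ).1.
have F'0 x : 0 <= F' x.
  by rewrite /F' patchE; case: ifPn => // /set_mem; exact: F0.
have F'E p : J p -> (fun s => F' (s, p)) = (fun s => F (s, p)) \_ I.
  move=> Jp; apply/funext => s; rewrite /F' !patchE.
  by congr (if _ then _ else _); apply/idP/idP; rewrite !inE /= => // -[].
have inner p : J p -> \int[mu]_s F' (s, p) = \int[mu]_(s in I) F (s, p).
  by move=> Jp; rewrite [RHS]integral_mkcond -F'E.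
split.
- rewrite [LHS]integral_mkcond; apply: (etrans (@fubini_tonelli2 _ _ RR RR R mu mu F' mF' F'0)).
  rewrite [RHS]integral_mkcond; apply: eq_integral => p _; rewrite /fubini_G patchE.
  case: ifPn => [/set_mem Jp|Jp]; first exact: inner.
  apply: integral0_eq => s _; rewrite /F' patchE; case: ifPn => // /set_mem[_ /= Jp'].
  by move: Jp; rewrite mem_set.
- have := @measurable_fun_fubini_tonelli_G _ _ RR RR R mu F' mF' F'0.
  move=> /(measurable_funS measurableT (@subsetT _ J)); apply: eq_measurable_fun => p.
  by rewrite inE => Jp; exact: inner.
- move=> p Jp; apply: (measurable_restrictT _ mI).2; rewrite -F'E//.
  exact: measurable_fun_pair1.
Qed.

Section one_slice.
Variables (I : set R) (w G : R -> R) (D l : R).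
Hypothesis mI : measurable (I : set RR).
Hypotheses (mw : measurable_fun (I : set RR) (w : RR -> RR))
  (mG : measurable_fun (I : set RR) (G : RR -> RR))
  (mGw : measurable_fun (I : set RR) ((fun s => (G s / w s)%R) : RR -> RR)).
Hypotheses (w0 : forall s, I s -> (0 < w s)%R) (G0 : forall s, I s -> (0 < G s)%R).
Hypotheses (D0 : (0 <= D)%R) (l0 : (0 < l)%R).
Hypothesis lE : \int[mu]_(s in I) (w s * G s)%:E = l%:E.

Let integral_wG (k : R) : (0 <= k)%R ->
  \int[mu]_(s in I) (k%:E * (w s * G s)%:E) = (k * l)%:E.
Proof.
move=> k0; rewrite ge0_integralZl ?lE//.
  by apply/measurable_EFinP; exact: measurable_funM.
by move=> s Is; rewrite lee_fin mulr_ge0// ltW// ?w0 ?G0.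
Qed.

(** Along one curve, [w] is sqrt |q|, [G] the speed and [l] the q-length. *)
Lemma slice_extremal_length : \int[mu]_(s in I) ((w s / l)%:E * (G s)%:E) = 1.
Proof.
transitivity (\int[mu]_(s in I) ((l^-1)%:E * (w s * G s)%:E)).
  by apply: eq_integral => s _; rewrite -!EFinM; congr EFin; rewrite mulrA (mulrC (w s)).
by rewrite integral_wG ?mulVf ?gt_eqF// invr_ge0 ltW.
Qed.

Lemma slice_extremal_energy :
  \int[mu]_(s in I) ((w s / l)%:E ^+ 2 * (D * (G s / w s))%:E) = (D / l)%:E.
Proof.
transitivity (\int[mu]_(s in I) ((D / l ^+ 2)%:E * (w s * G s)%:E)).
  apply: eq_integral => s /set_mem Is; rewrite -EFin_expe -!EFinM; congr EFin; field.
  by rewrite !gt_eqF// w0.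
rewrite integral_wG ?divr_ge0 ?sqr_ge0//; congr EFin.
by field; rewrite gt_eqF.
Qed.

Lemma slice_energy_ge (r : R -> \bar R) : measurable_fun (I : set RR) r ->
  (forall s, I s -> 0 <= r s) ->
  1 <= \int[mu]_(s in I) (r s * (G s)%:E) ->
  (D / l)%:E <= \int[mu]_(s in I) (r s ^+ 2 * (D * (G s / w s))%:E).
Proof.
move=> mr r0 r1.
have mk : measurable_fun (I : set RR) (fun s => (D * (G s / w s))%:E).
  by apply/measurable_EFinP; apply: measurable_funM.
have k0 s : I s -> 0 <= (D * (G s / w s))%:E.
  by move=> Is; rewrite lee_fin mulr_ge0// divr_ge0// ltW// ?w0 ?G0.
have mG' : measurable_fun (I : set RR) (fun s => r s * (G s)%:E).
  by apply: emeasurable_funM => //; exact/measurable_EFinP.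
have rG0 s : I s -> 0 <= r s * (G s)%:E.
  by move=> Is; rewrite mule_ge0 ?r0// lee_fin ltW// G0.
have m1 : measurable_fun (I : set RR) (fun s => r s ^+ 2 * (D * (G s / w s))%:E).
  by apply: emeasurable_funM => //; exact: emeasurable_funM.
have m2 : measurable_fun (I : set RR) (fun s => (w s / l)%:E ^+ 2 * (D * (G s / w s))%:E).
  apply: emeasurable_funM => //.
  have mwl : measurable_fun (I : set RR) (fun s => (w s / l)%:E).
    by apply/measurable_EFinP; apply: measurable_funM.
  exact: emeasurable_funM.
have Dl0 : (0 <= D / l)%R by rewrite divr_ge0// ltW.
(* The finite number D / l, which is the energy of w / l, is added to both sides: this completes the
   square while all integrands stay nonnegative. *)
rewrite -(leeD2rE (x := (D / l)%:E))// -{3}slice_extremal_energy -ge0_integralD//; last 2 first.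
- by move=> s Is; rewrite mule_ge0 ?k0// sqre_ge0.
- by move=> s Is; rewrite mule_ge0 ?k0// sqre_ge0.
apply: (@le_trans _ _ (\int[mu]_(s in I) ((D / l + D / l)%:E * (r s * (G s)%:E)))).
  rewrite ge0_integralZl ?lee_fin ?addr_ge0// -EFinD -[leLHS]mule1.
  by rewrite lee_wpmul2l// lee_fin addr_ge0.
apply: ge0_le_integral => //.
- by move=> s Is; rewrite mule_ge0 ?rG0// lee_fin addr_ge0.
- exact: emeasurable_funM.
- exact: emeasurable_funD.
move=> s Is; have ws := w0 s Is; have Gs := G0 s Is.
move: (r s) (r0 s Is) => [x| |]// => [x0|_].
  rewrite -!EFin_expe -!EFinM -EFinD lee_fin.
  rewrite -subr_ge0 (_ : (_ - _ = D * (G s / w s) * (x - w s / l) ^+ 2)%R).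
    by rewrite mulr_ge0 ?sqr_ge0// mulr_ge0// divr_ge0// ltW.
  by field; rewrite !gt_eqF.
(* Where [r] is infinite, D = 0 makes both sides zero by the convention 0 * oo = 0, and D > 0 makes
   the right side infinite. *)
have [->|Dn0] := eqVneq D 0%R; first by rewrite !mul0r addr0 mul0e !mule0 adde0.
have Dp : (0 < D)%R by rewrite lt_neqAle eq_sym Dn0.
rewrite [X in _ <= X + _](_ : _ = +oo) ?addye ?leey//.
by rewrite expe2 mulyy gt0_mulye// lte_fin mulr_gt0// divr_gt0.
Qed.

End one_slice.
End slices.

(** * The extremal problem in the coordinates (s, p) *)

Section extremal.
Context {R : realType}.
Notation RR := (measurableTypeR R).
Notation mu := (@lebesgue_measure R).
Notation mu2 := (@lebesgue_measure R \x @lebesgue_measure R)%E.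

Lemma open_rectangle (I J : set R) : open I -> open J -> open (I `*` J : set (R * R)).
Proof.
move=> oI oJ; rewrite openE => -[s p] [/= Is Jp].
by exists (I, J) => //=; split; apply: open_nbhs_nbhs.
Qed.

Variables (I J : set R) (V : set (R * R)) (T S : R * R -> R * R).
Variables (W G Jc : R * R -> R) (D : R -> R).
Let A : set (R * R) := I `*` J.
Hypotheses (oI : open I) (oJ : open J) (oV : open V).
Hypothesis TA : forall x, A x -> V (T x) /\ S (T x) = x.
Hypothesis SV : forall y, V y -> A (S y) /\ T (S y) = y.
Hypothesis cT : forall x, A x -> {for x, continuous T}.
Hypothesis cS : forall y, V y -> {for y, continuous S}.
Hypotheses (cW : forall y, V y -> {for y, continuous W})
  (cG : forall x, A x -> {for x, continuous G})
  (cJ : forall x, A x -> {for x, continuous Jc}).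
Hypotheses (W0 : forall y, V y -> 0 < W y) (G0 : forall x, A x -> 0 < G x).
Hypothesis D0 : forall p, J p -> 0 <= D p.
Hypothesis JE : forall s p, I s -> J p -> Jc (s, p) = D p * (G (s, p) / W (T (s, p))).
Hypothesis cov : forall f : RR * RR -> \bar R,
  measurable_fun (V : set (RR * RR)) f -> (forall y, V y -> (0 <= f y)%E) ->
  (\int[mu2]_(y in V) f y = \int[mu2]_(x in A) (f (T x) * (Jc x)%:E))%E.

Definition slice_length (p : R) : \bar R :=
  (\int[mu]_(s in I) (W (T (s, p)) * G (s, p))%:E)%E.
Hypothesis L0 : forall p, J p -> (0 < slice_length p < +oo)%E.

Definition extremal (y : R * R) : R := W y / fine (slice_length (S y).2).

Let mI : measurable (I : set RR). Proof. exact: open_measurable. Qed.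
Let mJ : measurable (J : set RR). Proof. exact: open_measurable. Qed.
Let oA : open A. Proof. exact: open_rectangle. Qed.
Let mV : measurable (V : set (RR * RR)). Proof. exact: open_measurable2. Qed.
Let cWT x : A x -> {for x, continuous (fun z => W (T z))}.
Proof.
move=> Ax; apply: continuous_comp; first exact: cT.
by apply: cW; case: (TA x Ax).
Qed.

Let mWT : measurable_fun (A : set (RR * RR)) ((fun x => W (T x)) : RR * RR -> RR).
Proof. exact: (continuous_measurable2 _ _ oA cWT). Qed.
Let mG : measurable_fun (A : set (RR * RR)) (G : RR * RR -> RR).
Proof. exact: (continuous_measurable2 _ _ oA cG). Qed.
Let mJc : measurable_fun (A : set (RR * RR)) (Jc : RR * RR -> RR).
Proof. exact: (continuous_measurable2 _ _ oA cJ). Qed.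
Let WT0 x : A x -> 0 < W (T x).
Proof. by move=> Ax; apply: W0; case: (TA x Ax). Qed.
Let mGW : measurable_fun (A : set (RR * RR)) ((fun x => G x / W (T x)) : RR * RR -> RR).
Proof.
apply: (continuous_measurable2 _ _ oA) => x Ax.
apply: cvgM; first exact: cG.
by apply: cvgV; [rewrite gt_eqF// WT0|exact: cWT].
Qed.

Let slice d (T' : measurableType d) (f : RR * RR -> T') p : J p ->
  measurable_fun (A : set (RR * RR)) f -> measurable_fun (I : set RR) (fun s => f (s, p)).
Proof.
move=> Jp mf.
have mp : measurable_fun (I : set RR) (fun s : RR => (s, p) : RR * RR).
  have mp := measurable_fun_pair (@measurable_id _ RR setT) (@measurable_cst _ _ RR RR setT p).
  exact: (measurable_funS measurableT (@subsetT _ I) mp).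
have sub : [set ((s, p) : RR * RR) | s in I] `<=` A by move=> _ [s Is <-].
exact: (measurable_comp (open_measurable2 _ oA) sub mf mp).
Qed.

Let LE p : J p -> slice_length p = (fine (slice_length p))%:E.
Proof.
by move=> /L0/andP[l0 l1]; rewrite fineK// ge0_fin_numE// ltW.
Qed.

Let l0 p : J p -> 0 < fine (slice_length p).
Proof. by move=> Jp; rewrite -lte_fin -LE//; case/andP: (L0 p Jp). Qed.

Let mL : measurable_fun (J : set RR) slice_length.
Proof.
have [] := @integral_rectangle R I J (fun x => (W (T x) * G x)%:E) mI mJ.
- by apply/measurable_EFinP; exact: measurable_funM.
- by move=> x Ax; rewrite lee_fin mulr_ge0// ltW// ?WT0// G0.
by [].
Qed.

(** The length of the curves need not be continuous in p; it is measurable as an inner integral in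
    Tonelli's theorem, and the second component of [S] carries this over to [V]. *)
Lemma measurable_extremal : measurable_fun (V : set (RR * RR)) (fun y => (extremal y)%:E).
Proof.
apply/measurable_EFinP; apply: measurable_funM.
  exact: (continuous_measurable2 _ _ oV cW).
have mS2 : measurable_fun (V : set (RR * RR)) ((fun y => (S y).2) : RR * RR -> RR).
  apply: (continuous_measurable2 _ _ oV) => y Vy.
  by apply: continuous_comp; [exact: cS|exact: cvg_snd].
have SJ : (fun y => (S y).2) @` V `<=` J by move=> _ [y Vy <-]; have [[_ +] _] := SV y Vy.
have ml : measurable_fun (J : set RR) ((fun p => (fine (slice_length p))^-1) : RR -> RR).
  (* On [J] the length is positive, so its inverse is its power of exponent -1, and powers are
     measurable on the whole line. *)
  apply: (@eq_measurable_fun _ _ RR RR J (fun p => fine (slice_length p) `^ (-1))).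
    by move=> p /[!inE] Jp; rewrite powR_inv1// ltW// l0.
  apply: (@measurableT_comp _ _ _ RR RR RR (fun x => x `^ (-1))); first exact: measurable_powR.
  by apply: measurableT_comp => //; exact: mL.
exact: (measurable_comp mJ SJ ml mS2).
Qed.

Let ST s p : I s -> J p -> S (T (s, p)) = (s, p).
Proof. by move=> Is Jp; case: (TA (s, p) (conj Is Jp)). Qed.

Let slW p (Jp : J p) := slice _ _ _ p Jp mWT.
Let slG p (Jp : J p) := slice _ _ _ p Jp mG.
Let slGW p (Jp : J p) := slice _ _ _ p Jp mGW.
Let W0s p (Jp : J p) : forall s, I s -> 0 < W (T (s, p)).
Proof. by move=> s Is; exact: WT0. Qed.
Let G0s p (Jp : J p) : forall s, I s -> 0 < G (s, p).
Proof. by move=> s Is; exact: G0. Qed.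

Lemma extremal_length p : J p ->
  (\int[mu]_(s in I) ((extremal (T (s, p)))%:E * (G (s, p))%:E) = 1)%E.
Proof.
move=> Jp; rewrite -(slice_extremal_length I _ _ _ mI (slW _ Jp) (slG _ Jp) (W0s _ Jp) (G0s _ Jp) (l0 _ Jp) (LE _ Jp)).
by apply: eq_integral => s /set_mem Is; rewrite /extremal ST.
Qed.

(** In the coordinates (s, p) both sides become integrals over p of slice energies with the same
    weight D G / W, so it suffices to compare them slice by slice. *)
Lemma extremal_min (f : RR * RR -> \bar R) :
  measurable_fun (V : set (RR * RR)) f -> (forall y, V y -> (0 <= f y)%E) ->
  (forall p, J p -> (1 <= \int[mu]_(s in I) (f (T (s, p)) * (G (s, p))%:E))%E) ->
  (\int[mu2]_(y in V) ((extremal y)%:E ^+ 2) <= \int[mu2]_(y in V) (f y ^+ 2))%E.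
Proof.
move=> mf f0 f1.
have key (h : RR * RR -> \bar R) : measurable_fun (V : set (RR * RR)) h ->
   (\int[mu2]_(y in V) (h y ^+ 2) = \int[mu]_(p in J) \int[mu]_(s in I)
      (h (T (s, p)) ^+ 2 * (D p * (G (s, p) / W (T (s, p))))%:E))%E /\
   measurable_fun (J : set RR) (fun p => \int[mu]_(s in I)
      (h (T (s, p)) ^+ 2 * (D p * (G (s, p) / W (T (s, p))))%:E))%E.
  move=> mh.
  have mh2 : measurable_fun (V : set (RR * RR)) (fun y => h y ^+ 2)%E.
    exact: emeasurable_funM.
  have h2 y : (0 <= h y ^+ 2)%E by exact: sqre_ge0.
  rewrite (cov _ mh2 (fun y _ => h2 y)).
  have mF : measurable_fun (A : set (RR * RR)) (fun x => h (T x) ^+ 2 * (Jc x)%:E)%E.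
    apply: emeasurable_funM; last by apply/measurable_EFinP; exact: mJc.
    have TV : T @` A `<=` V by move=> _ [x Ax <-]; case: (TA x Ax).
    exact: (measurable_comp mV TV mh2 (measurable_fun_continuous2 _ _ oA cT)).
  have F0 x : A x -> (0 <= h (T x) ^+ 2 * (Jc x)%:E)%E.
    case: x => s p [Is Jp]; rewrite mule_ge0// lee_fin JE// mulr_ge0 ?D0//.
    by rewrite divr_ge0// ltW// ?W0s ?G0s.
  have [-> m1 _] := integral_rectangle I J _ mI mJ mF F0.
  have inner p : J p -> (\int[mu]_(s in I) (h (T (s, p)) ^+ 2 * (Jc (s, p))%:E) =
     \int[mu]_(s in I) (h (T (s, p)) ^+ 2 * (D p * (G (s, p) / W (T (s, p))))%:E))%E.
    by move=> Jp; apply: eq_integral => s /set_mem Is; rewrite JE.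
  split; first by apply: eq_integral => p /set_mem; exact: inner.
  by apply: eq_measurable_fun m1 => p /set_mem; exact: inner.
have [-> m1] := key _ measurable_extremal; have [-> m2] := key _ mf.
apply: ge0_le_integral => //.
  move=> p Jp; apply: integral_ge0 => s Is.
  by rewrite mule_ge0 ?sqre_ge0// lee_fin mulr_ge0 ?D0// divr_ge0// ltW// ?W0s ?G0s.
move=> p Jp.
have fT0 s : I s -> (0 <= f (T (s, p)))%E.
  by move=> Is; apply: f0; case: (TA (s, p) (conj Is Jp)).
have mfT : measurable_fun (I : set RR) (fun s => f (T (s, p))).
  have TV : T @` A `<=` V by move=> _ [x Ax <-]; case: (TA x Ax).
  apply: (slice _ _ (f \o T)) => //.
  exact: (measurable_comp mV TV mf (measurable_fun_continuous2 _ _ oA cT)).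
have ge := slice_energy_ge I _ _ _ _ mI (slW _ Jp) (slG _ Jp) (slGW _ Jp) (W0s _ Jp) (G0s _ Jp)
  (D0 p Jp) (l0 _ Jp) (LE _ Jp) _ mfT fT0 (f1 p Jp).
apply: le_trans ge; rewrite le_eqVlt; apply/orP; left; apply/eqP.
rewrite -(slice_extremal_energy I _ _ _ _ mI (slW _ Jp) (slG _ Jp) (W0s _ Jp) (G0s _ Jp)
  (D0 p Jp) (l0 _ Jp) (LE _ Jp)).
by apply: eq_integral => s /set_mem Is; rewrite /extremal ST.
Qed.

End extremal.

(** * Horizontality and regularity in real coordinates *)

Lemma velocityE (R : realType) (Phi : R * R -> R[i]) (s p : R) :
  velocity (fun s => Phi (s, p)) s = toC ('D_e1 (@toR2 R \o Phi) (s, p)).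
Proof.
have h1 := derive1E (@toR2 R \o (fun s => Phi (s, p))) s.
have h2 := (partial1E _ (@toR2 R \o Phi) s p).2.
exact: (congr1 (@toC R) (etrans h1 h2)).
Qed.

Lemma normc_toC (R : realType) (g : R * R) : normc (toC g) = Num.sqrt (sqn g).
Proof. by rewrite /= /sqn -!expr2. Qed.

(** A positive number equals its own modulus, here |z| |g|^2, and none of its factors can vanish. *)
Lemma square_positive (R : realType) (z : R[i]) (g : R * R) : 0 < z * toC g ^+ 2 ->
  [/\ sq_im (toR2 z) g = 0, 0 < normc z, 0 < sqn g &
      sq_re (toR2 z) g = normc z * sqn g].
Proof.
move=> zg.
have E : z * toC g ^+ 2 = sq_re (toR2 z) g +i* sq_im (toR2 z) g.
  rewrite expr2; case: z g {zg} => a b [c d]; rewrite /sq_re /sq_im /=.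
  by apply/eqP; rewrite eq_complex/=; apply/andP; split; apply/eqP; ring.
move: (zg); rewrite {1}E ltcE/= => /andP[/eqP im re].
have n0 : normc z * sqn g = sq_re (toR2 z) g.
  have -> : sqn g = normc (toC g ^+ 2).
    rewrite expr2 normcM -expr2 normc_toC sqr_sqrtr//.
    by rewrite /sqn -!expr2 addr_ge0// sqr_ge0.
  by rewrite -normcM E im /= expr0n /= addr0 sqrtr_sqr gtr0_norm.
have s0 : 0 <= sqn g by rewrite /sqn -!expr2 addr_ge0// sqr_ge0.
have nz : 0 <= normc z by exact: normc_nonneg.
split => //; rewrite lt_neqAle ?s0 ?nz andbT eq_sym; apply/eqP => h0;
  by move: re; rewrite -n0 h0 ?mul0r ?mulr0 ltxx.
Qed.

Section continuity.
Context {R : realType}.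
Implicit Types f g : R * R -> R * R.

Lemma continuous_sqn f x : {for x, continuous f} ->
  {for x, continuous (fun y => Num.sqrt (sqn (f y)))}.
Proof.
move=> cf; apply: continuous_comp; last exact: sqrt_continuous.
have c1 : {for x, continuous (fun y => (f y).1)} by apply: continuous_comp; [exact: cf|exact: cvg_fst].
have c2 : {for x, continuous (fun y => (f y).2)} by apply: continuous_comp; [exact: cf|exact: cvg_snd].
by apply: cvgD; apply: cvgM.
Qed.

Lemma continuous_norm_jac2 f g x : {for x, continuous f} -> {for x, continuous g} ->
  {for x, continuous (fun y => `|jac2 (f y) (g y)|)}.
Proof.
move=> cf cg; apply: continuous_comp; last exact: norm_continuous.
have c1 : {for x, continuous (fun y => (f y).1)} by apply: continuous_comp; [exact: cf|exact: cvg_fst].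
have c2 : {for x, continuous (fun y => (f y).2)} by apply: continuous_comp; [exact: cf|exact: cvg_snd].
have c3 : {for x, continuous (fun y => (g y).1)} by apply: continuous_comp; [exact: cg|exact: cvg_fst].
have c4 : {for x, continuous (fun y => (g y).2)} by apply: continuous_comp; [exact: cg|exact: cvg_snd].
by apply: cvgB; apply: cvgM.
Qed.

Lemma jac2_det2 f x : differentiable f x ->
  `|jac2 ('D_e1 f x) ('D_e2 f x)| = `|det2 ('d f x)|.
Proof.
move=> df; have h1 := deriveE e1 df; have h2 := deriveE e2 df.
have jE a b c d : a = c -> b = d -> jac2 a b = c.1 * d.2 - d.1 * c.2 :> R.
  by move=> -> ->; rewrite /jac2 (mulrC c.2).
exact: (congr1 Num.norm (jE _ _ _ _ h1 h2)).
Qed.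

Lemma derive_comp_cmul2 (T q : R * R -> R * R) (c : R[i]) x w :
  differentiable T x -> differentiable q (T x) -> ('d q (T x) = cmul2 c :> (R * R -> R * R)) ->
  derivable (q \o T) x w /\ 'D_w (q \o T) x = cmul2 c ('D_w T x).
Proof.
move=> dT dq dqE; have dqT := differentiable_comp dT dq; split; first exact: diff_derivable.
have h1 := deriveE w dqT; have h2 := congr1 (fun h => h w) (diff_comp dT dq).
have h3 := congr1 (fun h => h ('d T x w)) dqE.
have h4 := congr1 (cmul2 c) (deriveE w dT).
exact: (etrans h1 (etrans h2 (etrans h3 (esym h4)))).
Qed.

End continuity.

Theorem theorem1 (R : realType) (I J : set R) (U : set R[i])
    (Phi : R * R -> R[i]) (Psi : R[i] -> R * R) (q : R[i] -> R[i]) :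
  open_interval I -> open_interval J -> open_in_C U ->
  C2_diffeomorphism (I `*` J) U Phi Psi ->
  holomorphic U q ->
  (forall c, coord_family I J Phi c -> horizontal_trajectory U q c) ->
  (forall z, U z -> (0 < l_Gamma I Phi Psi q z < +oo)%E) ->
  M2 U (coord_family I J Phi) =
  integral_C U (fun z => (normc (q z))%:E / l_Gamma I Phi Psi q z ^+ 2)%E.
Proof.
move=> [oI itvI [s0 Is0]] [oJ itvJ _] oU [PhiU PsiA [dT ddT] [dS _]] holq hortraj lpos.
set T := @toR2 R \o Phi in dT ddT; set S := Psi \o @toC R in dS.
pose V := @toC R @^-1` U; pose A : set (R * R) := I `*` J.
have oA : open A by exact: open_rectangle.
have oV : open V by exact: open_toC.
have toCT x : toC (T x) = Phi x by exact: toCK.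
have TA x : A x -> V (T x) /\ S (T x) = x.
  by move=> /PhiU[UP PP]; rewrite /V /S /= toCT.
have SV y : V y -> A (S y) /\ T (S y) = y.
  by move=> /PsiA[AP PP]; split => //; rewrite /T/= PP toR2K.
have dT' x v : A x -> derivable T x v by move=> /dT; exact: diff_derivable.
have ddT' x v w : A x -> derivable ('D_v T) x w.
  by move=> Ax; apply: diff_derivable; exact: (ddT v).1.
have cddT x v w : A x -> {for x, continuous ('D_w ('D_v T))} by move=> Ax; exact: (ddT v).2.
have cDT x v : A x -> {for x, continuous ('D_v T)}.
  by move=> Ax; apply: differentiable_continuous; exact: (ddT v).1.
pose qt := @toR2 R \o q \o @toC R.
have dqt x : A x -> exists c, differentiable qt (T x) /\
    ('d qt (T x) = cmul2 c :> (R * R -> R * R)).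
  by move=> /PhiU[UP _]; exact: (holomorphic_diff q (Phi x) (holq _ UP)).
have dQ x : A x -> exists c : R[i], forall w,
    derivable (qt \o T) x w /\ 'D_w (qt \o T) x = cmul2 c ('D_w T x).
  move=> Ax; have [c [h1 h2]] := dqt x Ax; exists c => w.
  by apply: derive_comp_cmul2 => //; exact: dT.
have pos x : A x -> [/\ sq_im ((qt \o T) x) ('D_e1 T x) = 0, 0 < normc (q (Phi x)),
    0 < sqn ('D_e1 T x) &
    sq_re ((qt \o T) x) ('D_e1 T x) = normc (q (Phi x)) * sqn ('D_e1 T x)].
  case: x => s p [Is Jp].
  have [_ /(_ s Is)] := hortraj (coord_curve I Phi p) (ex_intro2 _ _ p Jp erefl).
  rewrite /= velocityE => /square_positive.
  by rewrite /qt /= toCT.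
have g0 x : A x -> sqn ('D_e1 T x) != 0 by move=> /pos[_ _ h _]; rewrite gt_eqF.
have [D D0 DE] := jac_factor A T (qt \o T) oA dT' ddT' cddT dQ
  (fun x Ax => let: And4 h _ _ _ := pos x Ax in h) g0 I J (fun x => normc (q (Phi x))) erefl itvI
  (ex_intro _ s0 Is0) (fun x Ax => let: And4 _ h1 _ h2 := pos x Ax in conj h1 h2).
pose W y := Num.sqrt (normc (q (toC y))).
pose G x := Num.sqrt (sqn ('D_e1 T x)).
pose Jc x := `|jac2 ('D_e1 T x) ('D_e2 T x)|.
have cT x : A x -> {for x, continuous T} by move=> Ax; exact/differentiable_continuous/dT.
have cS y : V y -> {for y, continuous S} by move=> Vy; exact/differentiable_continuous/dS.
have cW y : V y -> {for y, continuous W}.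
  move=> /SV[/dqt[c [dq _]] TS]; rewrite TS in dq.
  (* The modulus of q is the Euclidean norm of [qt], hence the two nested roots; continuity then
     comes from the differentiability of q. *)
  rewrite (_ : W = fun y => Num.sqrt (Num.sqrt (sqn (qt y)))).
    apply: continuous_comp; last exact: sqrt_continuous.
    exact/continuous_sqn/differentiable_continuous.
  by apply/funext => z; rewrite /W -normc_toC -[q (toC z) in LHS]toCK.
have cG x : A x -> {for x, continuous G} by move=> Ax; exact/continuous_sqn/cDT.
have cJ x : A x -> {for x, continuous Jc}.
  by move=> Ax; apply: continuous_norm_jac2; exact: cDT.
have WT x : W (T x) = Num.sqrt (normc (q (Phi x))) by rewrite /W toCT.
have W0 y : V y -> 0 < W y.
  by move=> /SV[/pos[_ h _ _] TS]; rewrite -TS WT sqrtr_gt0.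
have G0 x : A x -> 0 < G x by move=> /pos[_ _ h _]; rewrite sqrtr_gt0.
have JE s p : I s -> J p -> Jc (s, p) = D p * (G (s, p) / W (T (s, p))).
  by move=> Is Jp; rewrite WT; exact: DE.
have cov f := change_of_variables2 A V T S Jc f oA oV TA SV dT dS cJ
  (fun x Ax => jac2_det2 T x (dT x Ax)).
have normv s p : normc (velocity (fun s => Phi (s, p)) s) = G (s, p).
  by rewrite velocityE normc_toC.
have LE p : q_length q (coord_curve I Phi p) = slice_length I T W G p.
  apply: eq_integral => s _.
  exact: (congr1 EFin (f_equal2 *%R (esym (WT (s, p))) (normv s p))).
have L0 p : J p -> (0 < slice_length I T W G p < +oo)%E.
  (* The hypothesis concerns points of [U]; the curve of parameter p passes through Phi (s0, p). *)
  move=> Jp; have [UP PP] := PhiU (s0, p) (conj Is0 Jp).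
  by have := lpos _ UP; rewrite /l_Gamma PP LE.
pose rho z : \bar R := (extremal I T S W G (toR2 z))%:E.
have rhoE y : rho (toC y) = (extremal I T S W G y)%:E by rewrite /rho toR2K.
have rhoPhi x : rho (Phi x) = (extremal I T S W G (T x))%:E by [].
have rhoU : integral_C U (fun z => (normc (q z))%:E / l_Gamma I Phi Psi q z ^+ 2)%E =
    integral_C U (fun z => rho z ^+ 2)%E.
  apply: eq_integral => y /set_mem Vy.
  have [[_ Jp] _] := SV y Vy.
  rewrite rhoE /l_Gamma LE /extremal.
  have /andP[l0 l1] := L0 _ Jp.
  have lE : slice_length I T W G (S y).2 = (fine (slice_length I T W G (S y).2))%:E.
    by rewrite fineK// ge0_fin_numE// ltW.
  have l0' : 0 < fine (slice_length I T W G (S y).2) by rewrite -lte_fin -lE.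
  (* As 0 < l < +oo, the quotient of extended reals is a real one, and W^2 = |q|. *)
  rewrite {1}lE -!EFin_expe inver expf_eq0/= gt_eqF//= -EFinM; congr EFin.
  by rewrite expr_div_n sqr_sqrtr// normc_nonneg.
have adm_rho : adm U (coord_family I J Phi) rho.
  split.
  - move=> z Uz; rewrite /rho lee_fin /extremal.
    have Vz : V (toR2 z) by rewrite /V /= toCK.
    have [[_ Jp] _] := SV _ Vz; have /andP[l0 _] := L0 _ Jp.
    by rewrite divr_ge0 ?(ltW (W0 _ Vz))// fine_ge0// ltW.
  - rewrite /borel_on (_ : rho \o @toC R = fun y => (extremal I T S W G y)%:E).
      exact: (measurable_extremal I J V T S W G oI oJ oV TA SV cT cS cW cG W0 G0 L0).
    by apply/funext => y; exact: rhoE.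
  - move=> _ [p Jp <-] /=.
    rewrite le_eqVlt; apply/orP; left; apply/eqP.
    rewrite -(extremal_length I J V T S W G oI oJ TA cT cW cG W0 G0 L0 p Jp).
    apply: eq_integral => s _.
    exact: (congr1 (fun x => rho (Phi (s, p)) * x%:E)%E (esym (normv s p))).
rewrite rhoU; apply/eqP; rewrite eq_le; apply/andP; split.
  by apply: ereal_inf_lbound; exists rho.
apply: le_ereal_inf_tmp => _ [f [f0 mf f1] <-].
have f1' p : J p ->
    (1 <= \int[@lebesgue_measure R]_(s in I) (f (toC (T (s, p))) * (G (s, p))%:E))%E.
  move=> Jp; have := f1 (coord_curve I Phi p) (ex_intro2 _ _ p Jp erefl).
  move=> /le_trans; apply; rewrite le_eqVlt; apply/orP; left; apply/eqP.
  apply: eq_integral => s _.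
  exact: (f_equal2 (fun z x => f z * x%:E)%E (esym (toCT (s, p))) (normv s p)).
have ge := extremal_min I J V T S W G Jc D oI oJ oV TA SV cT cS cW cG cJ W0 G0
  (fun p _ => D0 p) JE cov L0 (f \o @toC R) mf (fun y Vy => f0 (toC y) Vy) f1'.
apply: le_trans ge; rewrite le_eqVlt; apply/orP; left; apply/eqP.
by apply: eq_integral => y _; rewrite rhoE.
Qed.
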